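(* Let $\eta=(e(X),\mu_0(X),\mu_1(X))$, and assume strong ignorability: $(Y^0,Y^1)\perp\!\!\!\perp A\mid X$ and $0<e(x)<1$ for all $x$. Suppose the propensity score $e(\cdot)$ is known. (a) If in addition monotonicity $Y^0\le Y^1$ holds (so that $\beta=1-\mu_0/\mu_1$), then the efficient influence function of $\beta$ is \begin{align*} \tilde\phi_\beta(Y,A,X;\eta)&=\frac{\mu_0}{\mu_1^2}A(Y-\mu_1(X))-\frac{e(X)}{\mu_1}\frac{1-A}{1-e(X)}(Y-\mu_0(X))+\frac{\mu_0}{\mu_1^2}\mu_1(X)e(X)-\frac{1}{\mu_1}\mu_0(X)e(X)\\ &=\frac{1-\beta}{\mu_1}A(Y-\mu_1(X))-\frac{e(X)}{\mu_1}\frac{1-A}{1-e(X)}(Y-\mu_0(X))+\frac{1-\beta}{\mu_1}\mu_1(X)e(X)-\frac{1}{\mu_1}\mu_0(X)e(X), \end{align*} and the associated semiparametric efficiency bound of $\beta$ is $\mathbb{V}(\tilde\phi_\beta(Y,A,X;\eta))$. (b) If instead in addition conditional independence $Y^0\perp\!\!\!\perp Y^1\mid X$ holds (so that $\beta=1-\mu/\mu_1$), then the efficient influence function of $\beta$ is \begin{align*} \tilde\varphi_\beta(Y,A,X;\eta)&=\Big(\frac{\mu}{\mu_1^2}-\frac{\mu_0(X)}{\mu_1}\Big)A(Y-\mu_1(X))-\frac{e(X)}{\mu_1}\frac{1-A}{1-e(X)}\mu_1(X)(Y-\mu_0(X))+\Big(\frac{\mu}{\mu_1^2}-\frac{\mu_0(X)}{\mu_1}\Big)\mu_1(X)e(X)\\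 &=\Big(\frac{1-\beta}{\mu_1}-\frac{\mu_0(X)}{\mu_1}\Big)A(Y-\mu_1(X))-\frac{e(X)}{\mu_1}\frac{1-A}{1-e(X)}\mu_1(X)(Y-\mu_0(X))+\Big(\frac{1-\beta}{\mu_1}-\frac{\mu_0(X)}{\mu_1}\Big)\mu_1(X)e(X), \end{align*} and the associated semiparametric efficiency bound of $\beta$ is $\mathbb{V}(\tilde\varphi_\beta(Y,A,X;\eta))$.
   Context: Setting: $X$ is a $p$-dimensional covariate vector, $A\in\{0,1\}$ a binary cause, $Y\in\{0,1\}$ a binary outcome, $Y^0,Y^1\in\{0,1\}$ the potential outcomes, with $Y=AY^1+(1-A)Y^0$. The propensity score is $e(x)=\mathbb{P}(A=1\mid X=x)$; the outcome regressions are $\mu_a(x)=\mathbb{P}(Y=1\mid X=x,A=a)$, $a=0,1$. Constants: $\mu_a=\mathbb{E}[\mu_a(X)e(X)]$ for $a=0,1$, and $\mu=\mathbb{E}[\mu_1(X)\mu_0(X)e(X)]$. The probability of necessary causation is $\beta=\mathbb{P}(Y^0=0\mid A=1,Y=1)$, where $\mathbb{P}(A=1,Y=1)>0$. $\mathbb{V}$ denotes variance. Efficient influence function with known propensity score: write $f_a(y\mid x)$ for the conditional density of $Y^a$ given $X=x$ and $f(x)$ for the density of $X$. The observed-data density of $(Y,A,X)$ is $[f_1(y\mid x)e(x)]^a[f_0(y\mid x)(1-e(x))]^{1-a}f(x)$. A regular parametric submodel indexes $f_1,f_0,f$ (but not $e$, which is fixed at the known function) by a parameter $\theta$ (truth at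 $\theta_0$), with score $s(y,a,x;\theta)$; $\beta(\theta)$ is the identification formula for $\beta$ (stated in each part) evaluated at the submodel. The tangent space is $$\mathcal{T}=\{a\,s_1(y\mid x)+(1-a)s_0(y\mid x)+s(x)\},$$ where $\int s_a(y\mid x)f_a(y\mid x)\,dy=0$ for $a=0,1$ and $\int s(x)f(x)\,dx=0$. An influence function of $\beta$ is a mean-zero function $\psi(Y,A,X)$ with $\partial\beta(\theta)/\partial\theta|_{\theta=\theta_0}=\mathbb{E}[\psi(Y,A,X)\,s(Y,A,X;\theta_0)]$ for every regular parametric submodel; the efficient influence function is the influence function belonging to $\mathcal{T}$, and the semiparametric efficiency bound is its variance. *)

(* Defs.v *)
(* MathComp-Analysis *)
From HB Require Import structures.
From mathcomp Require Import all_boot all_order all_algebra.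
From mathcomp Require Import all_classical all_reals all_analysis.

Set Implicit Arguments.
Unset Strict Implicit.
Unset Printing Implicit Defensive.

Import Order.TTheory GRing.Theory Num.Theory.
Import numFieldNormedType.Exports.

Local Open Scope classical_set_scope.
Local Open Scope ring_scope.

Section conditioning.
Context {d d' : measure_display} {Omega : measurableType d}
  {T : measurableType d'} {R : realType}.
Variables (P : probability Omega R) (Z : Omega -> T).

(* g is a version of z |-> P(E | Z = z). *)
Definition is_cond_prob (E : set Omega) (g : T -> R) : Prop :=
  [/\ measurable_fun setT g,
      forall z, 0 <= g z <= 1 &
      forall B, measurable B ->
        P (E `&` Z @^-1` B) = (\int[P]_(w in Z @^-1` B) (g (Z w))%:E)%E].

(* U and V are independent given Z: the product of versions of the conditional
   probabilities of {U in C} and {V in D} is a version of that of the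
   intersection.  Since versions exist and are a.s. unique, it is immaterial
   whether they are quantified existentially or universally. *)
Definition cond_indep {d1 d2 : measure_display}
    {T1 : measurableType d1} {T2 : measurableType d2}
    (U : Omega -> T1) (V : Omega -> T2) : Prop :=
  forall (C : set T1) (D : set T2), measurable C -> measurable D ->
    exists g h : T -> R,
      [/\ is_cond_prob (U @^-1` C) g,
          is_cond_prob (V @^-1` D) h &
          is_cond_prob (U @^-1` C `&` V @^-1` D) (fun z => g z * h z)].

End conditioning.

Section estimands.
Context {d d' : measure_display} {Omega : measurableType d}
  {T : measurableType d'} {R : realType}.
Variables (P : probability Omega R) (X : Omega -> T).
Variables (e : T -> R) (mu : bool -> T -> R).

(* E[mu_a(X) e(X)] *)
Definition mu_const (a : bool) : R :=
  fine 'E_P[(fun w => mu a (X w) * e (X w))%R]%E.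

(* E[mu_1(X) mu_0(X) e(X)] *)
Definition mu_const_prod : R :=
  fine 'E_P[(fun w => mu true (X w) * mu false (X w) * e (X w))%R]%E.

(* P(Y^0 = 0 | A = 1, Y = 1) *)
Definition prob_necessary_causation (Y0 A Y : Omega -> bool) : R :=
  fine (P [set w | Y0 w = false /\ A w = true /\ Y w = true])
  / fine (P [set w | A w = true /\ Y w = true]).

End estimands.

(* In the curried functions below the arguments y and a are the values of the
   outcome and of the cause, coded by booleans; a conditional density
   f_a(y | x) is written f a y x, its dominating measure being the counting
   measure on bool. *)

(* A family of densities of (Y^a | X) and of X, indexed by a k-dimensional
   parameter.  The propensity score is not indexed. *)
Record submodel (R : realType) (T : Type) (k : nat) := Submodel {
  sub_par : set 'rV[R]_k ;
  sub_theta0 : 'rV[R]_k ;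
  sub_fY : 'rV[R]_k -> bool -> bool -> T -> R ;
  sub_fX : 'rV[R]_k -> T -> R }.

Section efficiency.
Context {d d' : measure_display} {Omega : measurableType d}
  {T : measurableType d'} {R : realType}.
Variables (P : probability Omega R) (nu : {measure set T -> \bar R}).
Variables (X : Omega -> T) (A Y : Omega -> bool).
Variables (e : T -> R) (fY : bool -> bool -> T -> R) (fX : T -> R).

Definition at_data (psi : bool -> bool -> T -> R) (w : Omega) : R :=
  psi (Y w) (A w) (X w).

(* Density of (Y, A, X) at parameter theta. *)
Definition obs_density {k : nat} (M : submodel R T k) (theta : 'rV[R]_k)
    (y a : bool) (x : T) : R :=
  (sub_fY M theta true y x * e x) ^+ a
  * (sub_fY M theta false y x * (1 - e x)) ^+ (1 - a)
  * sub_fX M theta x.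

(* Cramer-type regularity: the true law is attained at an interior point of the
   parameter set, the densities have partial derivatives, and those of f and
   of f_a have, respectively with weights 1 and f, a common integrable
   envelope. *)
Record regular_submodel {k : nat} (M : submodel R T k) : Prop := {
  reg_open : open (sub_par M) ;
  reg_theta0 : sub_par M (sub_theta0 M) ;
  reg_fY_meas : forall theta, sub_par M theta ->
    forall a y, measurable_fun setT (sub_fY M theta a y) ;
  reg_fY_ge0 : forall theta, sub_par M theta ->
    forall a y x, 0 <= sub_fY M theta a y x ;
  reg_fY_sum1 : forall theta, sub_par M theta ->
    forall a x, \sum_(y : bool) sub_fY M theta a y x = 1 ;
  reg_fX_meas : forall theta, sub_par M theta ->
    measurable_fun setT (sub_fX M theta) ;
  reg_fX_ge0 : forall theta, sub_par M theta ->
    forall x, 0 <= sub_fX M theta x ;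
  reg_fX_int1 : forall theta, sub_par M theta ->
    (\int[nu]_x (sub_fX M theta x)%:E = 1)%E ;
  reg_fY_true : forall a y x, sub_fY M (sub_theta0 M) a y x = fY a y x ;
  reg_fX_true : forall x, sub_fX M (sub_theta0 M) x = fX x ;
  reg_fY_derivable : forall theta, sub_par M theta -> forall j a y x,
    derivable (fun t => sub_fY M t a y x) theta (delta_mx 0 j) ;
  reg_fX_derivable : forall theta, sub_par M theta -> forall j x,
    derivable (fun t => sub_fX M t x) theta (delta_mx 0 j) ;
  reg_dominated : exists H : T -> R,
    nu.-integrable setT (EFin \o H) /\
    forall theta, sub_par M theta -> forall j x,
      `|'D_(delta_mx 0 j) (fun t => sub_fX M t x) theta| <= H x /\
      forall a y,
        `|'D_(delta_mx 0 j) (fun t => sub_fY M t a y x) theta|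
          * sub_fX M theta x <= H x }.

(* s j is the j-th component of the score at the truth; off the support of the
   law of (Y, A, X) its values are irrelevant. *)
Record is_score {k : nat} (M : submodel R T k)
    (s : 'I_k -> bool -> bool -> T -> R) : Prop := {
  score_meas : forall j y a, measurable_fun setT (s j y a) ;
  score_derive : forall j y a x, 0 < obs_density M (sub_theta0 M) y a x ->
    is_derive (sub_theta0 M) (delta_mx 0 j)
      (fun t => ln (obs_density M t y a x)) (s j y a x) ;
  score_sq_integrable : forall j,
    P.-integrable setT (fun w => ((at_data (s j) w) ^+ 2)%:E) }.

(* E_theta[mu_a(X; theta) e(X)], where mu_a(x; theta) = f_a(1 | x; theta). *)
Definition sub_mu {k : nat} (M : submodel R T k) (theta : 'rV[R]_k)
    (a : bool) : R :=
  \int[nu]_x (sub_fY M theta a true x * e x * sub_fX M theta x).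

(* E_theta[mu_1(X; theta) mu_0(X; theta) e(X)] *)
Definition sub_mu_prod {k : nat} (M : submodel R T k) (theta : 'rV[R]_k) : R :=
  \int[nu]_x (sub_fY M theta true true x * sub_fY M theta false true x
              * e x * sub_fX M theta x).

Definition beta_monotone (k : nat) (M : submodel R T k) (theta : 'rV[R]_k) : R :=
  1 - sub_mu M theta false / sub_mu M theta true.

Definition beta_cond_indep (k : nat) (M : submodel R T k) (theta : 'rV[R]_k) : R :=
  1 - sub_mu_prod M theta / sub_mu M theta true.

Definition in_tangent_space (psi : bool -> bool -> T -> R) : Prop :=
  exists (s_ : bool -> bool -> T -> R) (s : T -> R),
    [/\ (forall a y, measurable_fun setT (s_ a y)) /\ measurable_fun setT s,
        forall a, {ae nu, forall x, 0 < fX x ->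
          \sum_(y : bool) s_ a y x * fY a y x = 0},
        nu.-integrable setT (fun x => (s x * fX x)%:E) /\
          \int[nu]_x (s x * fX x) = 0 &
        forall y a x,
          psi y a x = a%:R * s_ true y x + (1 - a%:R) * s_ false y x + s x].

Section influence.
(* beta_ k M theta is the value of the estimand at the parameter theta of M. *)
Variable beta_ : forall k, submodel R T k -> 'rV[R]_k -> R.

Definition is_influence_function (psi : bool -> bool -> T -> R) : Prop :=
  [/\ forall y a, measurable_fun setT (psi y a),
      P.-integrable setT (EFin \o at_data psi),
      ('E_P[at_data psi] = 0)%E &
      forall k (M : submodel R T k) (s : 'I_k -> bool -> bool -> T -> R),
        regular_submodel M -> is_score M s -> forall j : 'I_k,
        P.-integrable setT (fun w => (at_data psi w * at_data (s j) w)%:E) /\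
        is_derive (sub_theta0 M) (delta_mx 0 j) (beta_ M)
          (fine 'E_P[(fun w => at_data psi w * at_data (s j) w)%R]%E)].

Definition is_influence_in_tangent (psi : bool -> bool -> T -> R) : Prop :=
  is_influence_function psi /\ in_tangent_space psi.

(* The definite article is part of the notion: psi is, up to almost sure
   equality, the only influence function in the tangent space. *)
Definition is_efficient_influence_function (psi : bool -> bool -> T -> R) : Prop :=
  is_influence_in_tangent psi /\
  forall psi', is_influence_in_tangent psi' ->
    {ae P, forall w, at_data psi' w = at_data psi w}.

(* Extended-real valued: strict positivity of 1 - e alone does not make the
   variance finite. *)
Definition is_efficiency_bound (b : \bar R) : Prop :=
  exists psi, is_efficient_influence_function psi /\ b = 'V_P[at_data psi]%E.

End influence.
End efficiency.

Section formulas.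
Context {T : Type} {R : realType}.
Variables (e : T -> R) (mu : bool -> T -> R).

Definition phi_monotone (m0 m1 : R) (y a : bool) (x : T) : R :=
  m0 / m1 ^+ 2 * a%:R * (y%:R - mu true x)
  - e x / m1 * ((1 - a%:R) / (1 - e x)) * (y%:R - mu false x)
  + m0 / m1 ^+ 2 * mu true x * e x
  - 1 / m1 * mu false x * e x.

Definition phi_monotone_beta (beta m1 : R) (y a : bool) (x : T) : R :=
  (1 - beta) / m1 * a%:R * (y%:R - mu true x)
  - e x / m1 * ((1 - a%:R) / (1 - e x)) * (y%:R - mu false x)
  + (1 - beta) / m1 * mu true x * e x
  - 1 / m1 * mu false x * e x.

Definition phi_cond_indep (m m1 : R) (y a : bool) (x : T) : R :=
  (m / m1 ^+ 2 - mu false x / m1) * a%:R * (y%:R - mu true x)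
  - e x / m1 * ((1 - a%:R) / (1 - e x)) * mu true x * (y%:R - mu false x)
  + (m / m1 ^+ 2 - mu false x / m1) * mu true x * e x.

Definition phi_cond_indep_beta (beta m1 : R) (y a : bool) (x : T) : R :=
  ((1 - beta) / m1 - mu false x / m1) * a%:R * (y%:R - mu true x)
  - e x / m1 * ((1 - a%:R) / (1 - e x)) * mu true x * (y%:R - mu false x)
  + ((1 - beta) / m1 - mu false x / m1) * mu true x * e x.

End formulas.

(* Main.v *)
Require Import Defs.
From HB Require Import structures.
From mathcomp Require Import all_boot all_order all_algebra.
From mathcomp Require Import all_classical all_reals all_analysis.
From mathcomp Require Import measurable_realfun ring lra.
Import Order.TTheory GRing.Theory Num.Theory.
Import numFieldNormedType.Exports.
Local Open Scope classical_set_scope.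
Local Open Scope ring_scope.

Set Implicit Arguments.
Unset Strict Implicit.
Unset Printing Implicit Defensive.

(* By ignorability the law of (Y, A, X) has density f_a(y | x) c_a(x) f(x), where
   c_1 = e and c_0 = 1 - e, and mu_a(x) = f_a(1 | x) on the support of X.
   In a regular submodel, score times density is c_a D(f_a f), which is dominated,
   so differentiating the ratio defining beta under the integral sign and comparing
   pointwise with psi * score * density shows that psi is an influence function.
   Since e / (1 - e) is unbounded, psi may fail to be square integrable;
   integrability comes from the boundedness of psi c_a.

   For uniqueness, let delta = a t_1 + (1 - a) t_0 + r be the difference of two
   influence functions of the tangent space.  It is orthogonal to the score of
   every submodel.  In the submodel f_a (1 + theta b_a), f (1 + theta c) with
   b_a = rho_a t_a and c = rho r - const, where the damping factors rho > 0 depend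
   only on x and make b_a and c bounded, the cross terms vanish by centering and
   the inner product of delta with the score b + c is the integral of
   sum_a c_a rho_a sum_y t_a^2 f_a + rho r^2 >= 0, whence delta = 0. *)

(** * Densities and conditional probabilities *)

(** Three obstacles shape the argument. A score is constrained only where the density of (Y, A, X)
    is positive, so comparisons run through G_a = D(f_a f) instead: it makes sense everywhere and
    vanishes with the density, because a nonnegative function has zero derivative at an interior
    zero. Next, [mu] and [fY] are arbitrary versions, which agree only almost everywhere on the
    support of X; identities are therefore claimed almost everywhere where [fX] is positive, or
    after multiplication by a quantity that vanishes off the support. Last, the difference of two
    influence functions need not be bounded or square integrable, so it cannot itself be a score;
    damping by exp(-t^2) repairs this.

    The formulas come from the chain rule. For both values of a, the sum of G_a(y) over y is D f, so
    that a function with weights u, v, r as in [weighted] pairs with the score to u e G_1(1) - v e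
    G_0(1) plus a multiple of D f. The derivative of beta has the same form; the coefficients of
    G_1(1), G_0(1) and D f give u, v and r. *)

Section density.
Context {d : measure_display} {T : measurableType d} {R : realType}.
Variables (m1 m2 : {measure set T -> \bar R}) (f : T -> R).
Hypotheses (mf : measurable_fun setT f) (f0 : forall x, 0 <= f x).
Hypothesis dens : forall B, measurable B ->
  m1 B = (\int[m2]_(x in B) (f x)%:E)%E.

Import HBNNSimple.

(** The density is known only through its integrals over sets, so the change of measure is built up
    from the level sets of simple functions. *)
Lemma nnsfun_integral_density (h : {nnsfun T >-> R}) :
  (\int[m1]_x (h x)%:E = \int[m2]_x ((h x)%:E * (f x)%:E))%E.
Proof.
rewrite integralT_nnsfun sintegralE.
transitivity (\int[m2]_x \sum_(r \in range h)
    (r%:E * (\1_(h @^-1` [set r]) x * f x)%:E))%E; last first.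
  apply: eq_integral => x _; rewrite [in RHS](fimfunE h) -fsumEFin// ge0_mule_fsuml.
    by apply: eq_fsbigr => r _; rewrite -!EFinM mulrA.
  by move=> r; rewrite lee_fin; case: (boolP (x \in h @^-1` [set r])) => xr;
    rewrite indicE ?xr ?(negbTE xr) ?mulr0// mulr1; move: xr; rewrite inE => /= <-.
have m1f (B : set T) : measurable B ->
    measurable_fun setT (EFin \o (fun x => \1_B x * f x : R)).
  by move=> mB; apply/measurable_EFinP/measurable_funM.
rewrite ge0_integral_fsum//.
- apply: eq_fsbigr => r rh.
  have [y _ hyr] : range h r by move: rh; rewrite inE.
  rewrite ge0_integralZl//; last 3 first.
  + exact: m1f.
  + by move=> x _; rewrite lee_fin mulr_ge0.
  + by rewrite -hyr lee_fin.
  congr (_ * _)%E; rewrite dens// integral_mkcond/=.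
  by apply: eq_integral => x _; rewrite patchE indicE; case: ifP; rewrite ?mul1r ?mul0r.
- by move=> r; apply: measurable_funeM; exact: m1f.
- move=> r x _; rewrite -EFinM lee_fin indicE.
  by case: (boolP (x \in h @^-1` [set r])) => xr;
    rewrite ?mul0r ?mulr0// mul1r mulr_ge0//;
    move: xr; rewrite inE => /= <-.
Qed.

Lemma ge0_integral_density (h : T -> \bar R) : measurable_fun setT h ->
  (forall x, 0 <= h x)%E ->
  (\int[m1]_x h x = \int[m2]_x (h x * (f x)%:E))%E.
Proof.
move=> mh h0; pose g := nnsfun_approx measurableT mh.
have hE : h = (fun x => limn (EFin \o g^~ x)).
  by apply/funext => x; apply/esym/cvg_lim => //; apply: cvg_nnsfun_approx.
transitivity (limn (fun n => \int[m1]_x (g n x)%:E))%E.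
  rewrite -monotone_convergence//.
  - by apply: eq_integral => x _; rewrite hE.
  - by move=> n; apply/measurable_EFinP.
  - by move=> n x _; rewrite lee_fin.
  - by move=> x _ a b ab; rewrite lee_fin; exact/lefP/nd_nnsfun_approx.
under eq_fun do rewrite nnsfun_integral_density.
rewrite -monotone_convergence//.
- apply: eq_integral => x _; apply/cvg_lim => //; apply: cvgeZr => //.
  exact: cvg_nnsfun_approx.
- by move=> n; apply: emeasurable_funM; apply/measurable_EFinP.
- by move=> n x _; rewrite mule_ge0// lee_fin.
- move=> x _ a b ab; rewrite lee_wpmul2r ?lee_fin//.
  exact/lefP/nd_nnsfun_approx.
Qed.

Lemma integrable_density (h : T -> R) : measurable_fun setT h ->
  m1.-integrable setT (EFin \o h) <->
  m2.-integrable setT (fun x => (h x * f x)%:E).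
Proof.
move=> mh; have mhf : measurable_fun setT (fun x => (h x * f x)%:E).
  by apply/measurable_EFinP/measurable_funM.
have E : (\int[m1]_x `|(h x)%:E| = \int[m2]_x `|(h x * f x)%:E|)%E.
  rewrite ge0_integral_density//.
    by apply: eq_integral => x _; rewrite EFinM abseM (@gee0_abs _ (f x)%:E)// lee_fin.
  by apply: measurableT_comp => //; exact/measurable_EFinP.
split=> /integrableP[_ hoo]; apply/integrableP; split => //.
- by rewrite -E.
- exact/measurable_EFinP.
- by rewrite /comp E.
Qed.

(** As [f] is nonnegative, multiplication by it commutes with taking positive and negative parts. *)
Lemma integral_density (h : T -> R) : measurable_fun setT h ->
  (\int[m1]_x (h x)%:E = \int[m2]_x (h x * f x)%:E)%E.
Proof.
move=> mh; have mEh : measurable_fun setT (EFin \o h) by exact/measurable_EFinP.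
rewrite integralE [RHS]integralE; congr (_ - _)%E.
- rewrite ge0_integral_density//; last exact: measurable_funepos.
  apply: eq_integral => x _; rewrite !funeposE -!EFin_max -EFinM.
  by rewrite maxr_pMl// mul0r.
- rewrite ge0_integral_density//; last exact: measurable_funeneg.
  apply: eq_integral => x _; rewrite !funenegE -!EFinN -!EFin_max -EFinM.
  by rewrite maxr_pMl// mul0r mulNr.
Qed.

End density.

Section pushforward.
Context {d d' : measure_display} {Omega : measurableType d}
  {T : measurableType d'} {R : realType}.
Variables (m : {measure set Omega -> \bar R}) (Z : {mfun Omega >-> T}).

Lemma integrable_pushforwardP (h : T -> R) : measurable_fun setT h ->
  (pushforward m Z).-integrable setT (EFin \o h) <->
  m.-integrable setT (fun w => (h (Z w))%:E).
Proof.
move=> mh; have mEh : measurable_fun setT (EFin \o h) by exact/measurable_EFinP.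
have E : (\int[pushforward m Z]_x `|(h x)%:E| = \int[m]_w `|(h (Z w))%:E|)%E.
  rewrite ge0_integral_pushforward//.
  by apply: measurableT_comp.
split=> /integrableP[_ hoo]; apply/integrableP; split => //.
- by apply/measurable_EFinP; exact: measurableT_comp.
- by rewrite -E.
- by rewrite /comp E.
Qed.

End pushforward.

(** * Tower property for versions of a conditional probability *)

Section conditional_probability.
Context {d d' : measure_display} {Omega : measurableType d}
  {T : measurableType d'} {R : realType}.
Variable P : probability Omega R.

Lemma bounded_integrable (f : Omega -> R) (M : R) : measurable_fun setT f ->
  (forall w, `|f w| <= M) -> P.-integrable setT (EFin \o f).
Proof.
move=> mf fM; apply: measurable_bounded_integrable => //.
  by rewrite (le_lt_trans (probability_le1 P measurableT))// ltry.
exists M; split; first exact: num_real.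
by move=> x Mx w _; exact: le_trans (fM w) (ltW Mx).
Qed.

Variable Z : {mfun Omega >-> T}.

Section tower.
Variables (E : set Omega) (q : T -> R).
Hypotheses (mE : measurable E) (Eq : is_cond_prob P Z E q).

Let mq : measurable_fun setT q. Proof. by case: Eq. Qed.
Let q0 x : 0 <= q x. Proof. by case: Eq => _ /(_ x)/andP[]. Qed.

(** That [q] is a version of P(E | Z) means exactly that the image under Z of P restricted to E has
    density [q] with respect to the law of Z. Conditioning thus becomes a change of measure. *)
Let event_density B : measurable B ->
  pushforward (mrestr P mE) Z B = (\int[pushforward P Z]_(x in B) (q x)%:E)%E.
Proof.
move=> mB; rewrite ge0_integral_pushforward//; last 2 first.
- by apply/measurable_EFinP; exact: measurable_funTS.
- by move=> x _; rewrite lee_fin.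
by case: Eq => _ _ /(_ B mB) <-; rewrite /pushforward /mrestr setIC.
Qed.

Let restr_density (B : set Omega) : measurable B ->
  mrestr P mE B = (\int[P]_(w in B) (\1_E w)%:E)%E.
Proof. by move=> mB; rewrite integral_indic// /mrestr setIC. Qed.

Let indic0 (w : Omega) : 0 <= \1_E w :> R. Proof. by []. Qed.

Lemma integrable_cond_prob (h : T -> R) : measurable_fun setT h ->
  P.-integrable setT (fun w => (h (Z w) * \1_E w)%:E) <->
  P.-integrable setT (fun w => (h (Z w) * q (Z w))%:E).
Proof.
move=> mh.
have mhZ : measurable_fun setT (h \o Z) by exact: measurableT_comp.
apply: iff_trans.
  by apply: iff_sym; exact: (integrable_density _ indic0 restr_density mhZ).
apply: iff_trans; first by apply: iff_sym; exact: integrable_pushforwardP.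
apply: iff_trans; first exact: (integrable_density mq q0 event_density mh).
by apply: (@integrable_pushforwardP _ _ _ _ _ _ _ (h \* q)); exact: measurable_funM.
Qed.

(** Both sides are the integral of [h] against the image under Z of P restricted to E. The
    restriction has density the indicator of E on Omega, and its image has density [q] on the law of
    Z. *)
Lemma integral_cond_prob (h : T -> R) : measurable_fun setT h ->
  P.-integrable setT (fun w => (h (Z w) * \1_E w)%:E) ->
  (\int[P]_w (h (Z w) * \1_E w)%:E = \int[P]_w (h (Z w) * q (Z w))%:E)%E.
Proof.
move=> mh ih.
have mhZ : measurable_fun setT (h \o Z) by exact: measurableT_comp.
rewrite -(integral_density _ indic0 restr_density mhZ)//.
have mhq : measurable_fun setT (EFin \o (h \* q)).
  by apply/measurable_EFinP; exact: measurable_funM.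
rewrite -(@integral_pushforward _ _ _ _ _ _ _ _ setT _ mhq)//; last first.
  by rewrite preimage_setT; exact: (integrable_cond_prob mh).1.
rewrite -(integral_density mq q0 event_density mh)//.
rewrite (@integral_pushforward _ _ _ _ _ _ _ _ setT)//; first exact/measurable_EFinP.
by rewrite preimage_setT; exact: (integrable_density _ indic0 restr_density mhZ).2.
Qed.

End tower.
End conditional_probability.

Lemma ge0_integral_eq0_ae {d : measure_display} {T : measurableType d}
    {R : realType} (m : {measure set T -> \bar R}) (g : T -> R) :
  measurable_fun setT g -> (forall x, 0 <= g x) ->
  (\int[m]_x (g x)%:E = 0)%E -> {ae m, forall x, g x = 0}.
Proof.
move=> mg g0 ig0.
have /(ae_eq_integral_abs m measurableT) : measurable_fun setT (EFin \o g).
  exact/measurable_EFinP.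
case=> + _; rewrite (_ : \int[m]_x _ = 0)%E; last first.
  by rewrite -ig0; apply: eq_integral => x _; rewrite gee0_abs// lee_fin.
by move=> /(_ erefl); apply: filterS => x /(_ I) [].
Qed.

(** * Uniqueness of versions, conditional independence, regressions *)

Section versions.
Context {d d' : measure_display} {Omega : measurableType d}
  {T : measurableType d'} {R : realType}.
Variables (P : probability Omega R) (Z : {mfun Omega >-> T}).

(** Testing both versions against h = q - r gives E[h q] = E[h 1_E] = E[h r], hence E[h^2] = 0. *)
Lemma is_cond_prob_unique (E : set Omega) (q r : T -> R) : measurable E ->
  is_cond_prob P Z E q -> is_cond_prob P Z E r ->
  {ae P, forall w, q (Z w) = r (Z w)}.
Proof.
move=> mE Eq Er; have [mq q01 _] := Eq; have [mr r01 _] := Er.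
pose h x := q x - r x.
have mh : measurable_fun setT h by exact: measurable_funB.
have h1 x : `|h x| <= 1.
  by rewrite ler_norml /h; have := q01 x; have := r01 x; lra.
have int (g : T -> R) : measurable_fun setT g -> (forall x, `|g x| <= 1) ->
    P.-integrable setT (fun w => (h (Z w) * g (Z w))%:E).
  move=> mg g1; apply: (@bounded_integrable _ _ _ _ _ 1).
    by apply: measurable_funM; exact: measurableT_comp.
  by move=> w; rewrite normrM mulr_ile1.
have iq : P.-integrable setT (fun w => (h (Z w) * q (Z w))%:E).
  by apply: int => // x; rewrite ler_norml; have := q01 x; lra.
have ir : P.-integrable setT (fun w => (h (Z w) * r (Z w))%:E).
  by apply: int => // x; rewrite ler_norml; have := r01 x; lra.
have iE := (integrable_cond_prob mE Eq mh).2 iq.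
have := integral_cond_prob mE Eq mh iE.
rewrite (integral_cond_prob mE Er mh iE) => qr.
have : {ae P, forall w, h (Z w) ^+ 2 = 0}.
  apply: ge0_integral_eq0_ae => [|w|]; last 1 first.
  - transitivity (\int[P]_w ((h (Z w) * q (Z w))%:E - (h (Z w) * r (Z w))%:E))%E.
      by apply: eq_integral => w _; rewrite -EFinB -mulrBr -expr2.
    rewrite integralB_EFin// qr subee//.
    exact: integrable_fin_num.
  - by apply: measurable_funX; exact: measurableT_comp.
  - exact: sqr_ge0.
by apply: filterS => w /eqP; rewrite sqrf_eq0 subr_eq0 => /eqP.
Qed.

Lemma is_cond_prob_ae_eq (E : set Omega) (q r : T -> R) :
  is_cond_prob P Z E q -> measurable_fun setT r ->
  (forall z, 0 <= r z <= 1) -> {ae P, forall w, q (Z w) = r (Z w)} ->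
  is_cond_prob P Z E r.
Proof.
move=> [mq _ Eq] mr r01 qr; split => // B mB; rewrite Eq//.
have mZ : measurable_fun (Z @^-1` B) Z by exact: measurable_funTS.
apply: ae_eq_integral => //.
- by rewrite -[_ @^-1` _]setTI; exact: measurable_funP.
- by apply/measurable_EFinP; apply: measurableT_comp.
- by apply/measurable_EFinP; apply: measurableT_comp.
- by apply: filterS qr => w -> _.
Qed.

Lemma is_cond_probC (E : set Omega) (q : T -> R) : measurable E ->
  is_cond_prob P Z E q -> is_cond_prob P Z (~` E) (fun z => 1 - q z).
Proof.
move=> mE [mq q01 Eq]; split => [|z|B mB].
- exact: measurable_funB.
- by have := q01 z; lra.
have mZB : measurable (Z @^-1` B) by rewrite -[_ @^-1` _]setTI; exact: measurable_funP.
have mqZ : measurable_fun setT (q \o Z) by exact: measurableT_comp.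
under eq_integral do rewrite EFinB.
rewrite integralB_EFin//; last 2 first.
- apply: (@integrableS _ _ _ _ setT) => //.
  by apply: (@bounded_integrable _ _ _ _ (cst 1) 1) => // w; rewrite normr1.
- apply: (@integrableS _ _ _ _ setT) => //.
  apply: (@bounded_integrable _ _ _ _ _ 1) => // w.
  by rewrite ler_norml/=; have := q01 (Z w); lra.
rewrite -Eq// integral_cst// mul1e.
rewrite (_ : ~` E `&` _ = Z @^-1` B `\` E); last by rewrite setDE setIC.
by rewrite measureD// 1?setIC// (le_lt_trans (probability_le1 P mZB))// ltry.
Qed.

(** [cond_indep] only provides some versions; almost sure uniqueness moves the product formula to
    the prescribed ones. *)
Lemma cond_indep_cond_prob {d1 d2 : measure_display} {T1 : measurableType d1}
    {T2 : measurableType d2} (U : {mfun Omega >-> T1}) (V : {mfun Omega >-> T2})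
    (C : set T1) (D : set T2) (q r : T -> R) :
  cond_indep P Z U V -> measurable C -> measurable D ->
  is_cond_prob P Z (U @^-1` C) q -> is_cond_prob P Z (V @^-1` D) r ->
  is_cond_prob P Z (U @^-1` C `&` V @^-1` D) (fun z => q z * r z).
Proof.
move=> UV mC mD Cq Dr; have [g [h [Cg Dh CDgh]]] := UV C D mC mD.
have mUC : measurable (U @^-1` C) by rewrite -[_ @^-1` _]setTI; exact: measurable_funP.
have mVD : measurable (V @^-1` D) by rewrite -[_ @^-1` _]setTI; exact: measurable_funP.
have gq := is_cond_prob_unique mUC Cg Cq.
have hr := is_cond_prob_unique mVD Dh Dr.
case: Cq Dr => mq q01 _ [mr r01 _].
apply: (is_cond_prob_ae_eq CDgh).
- exact: measurable_funM.
- move=> z; have /andP[? ?] := q01 z; have /andP[? ?] := r01 z.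
  by rewrite mulr_ge0 ?mulr_ile1.
- by apply: filterS2 gq hr => w -> ->.
Qed.

(** With k = mu_a p - r, the tower property used for (Z, A) and for Z gives E[k r] =
    E[k 1_E 1_{A=a}] = E[k mu_a 1_{A=a}] = E[k mu_a p], so E[k^2] = 0. *)
Lemma regression_ae (A : {mfun Omega >-> bool}) (a : bool) (E : set Omega)
    (mu : bool -> T -> R) (p r : T -> R) : measurable E ->
  is_cond_prob P (fun w => (Z w, A w)) E (fun z => mu z.2 z.1) ->
  is_cond_prob P Z (A @^-1` [set a]) p ->
  is_cond_prob P Z (E `&` A @^-1` [set a]) r ->
  {ae P, forall w, mu a (Z w) * p (Z w) = r (Z w)}.
Proof.
move=> mE Emu Ap Er; have [mmu mu01 _] := Emu.
have [mp p01 _] := Ap; have [mr r01 _] := Er.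
have mAa : measurable (A @^-1` [set a]) by rewrite -[_ @^-1` _]setTI; exact: measurable_funP.
have mmua : measurable_fun setT (mu a).
  rewrite (_ : mu a = (fun z => mu z.2 z.1) \o (fun z => (z, a)))//.
  by apply: measurableT_comp => //; exact: measurable_pair2.
pose k x := mu a x * p x - r x.
have mk : measurable_fun setT k by apply: measurable_funB => //; exact: measurable_funM.
have kle1 x : `|k x| <= 1.
  have /andP[m0 m1] := mu01 (x, a); have /andP[? ?] := p01 x.
  have /andP[? ?] := r01 x; rewrite /= in m0 m1.
  have : 0 <= mu a x * p x <= 1 by rewrite mulr_ge0// mulr_ile1.
  by rewrite ler_norml /k; lra.
have ind1 (S : set Omega) w : `|\1_S w : R| <= 1.
  by rewrite indicE; case: (_ \in _); rewrite ?normr1 ?normr0.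
have mind (S : set Omega) : measurable S -> measurable_fun setT (\1_S : Omega -> R).
  by move=> mS; exact: measurable_indic.
have mZk : measurable_fun setT (k \o Z) by exact: measurableT_comp.
have mZmu : measurable_fun setT (mu a \o Z) by exact: measurableT_comp.
have bnd (f : Omega -> R) : measurable_fun setT f -> (forall w, `|f w| <= 1) ->
  P.-integrable setT (EFin \o f) by move=> mf; exact: bounded_integrable.
have intr : P.-integrable setT (fun w => (k (Z w) * r (Z w))%:E).
  apply: bnd => [|w].
    by apply: measurable_funM => //; exact: measurableT_comp.
  rewrite normrM mulr_ile1//; have := r01 (Z w); rewrite ler_norml; lra.
have intmp : P.-integrable setT (fun w => (k (Z w) * (mu a (Z w) * p (Z w)))%:E).
  apply: bnd => [|w].
    by apply: measurable_funM => //; apply: measurable_funM => //; exact: measurableT_comp.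
  rewrite !normrM !mulr_ile1// ?mulr_ge0//; last by have := p01 (Z w); rewrite ler_norml; lra.
  by have := mu01 (Z w, a); rewrite ler_norml/=; lra.
have ZA : measurable_fun setT (fun w => (Z w, A w)) by exact: measurable_fun_pair.
pose ZAf := mfun_Sub (mem_set ZA : (fun w => (Z w, A w)) \in mfun).
(* The indicator of A = a belongs to the test function on (Z, A); it turns [mu (A w)] into
   [mu a]. *)
pose h (z : T * bool) := k z.1 * (z.2 == a)%:R.
have mh : measurable_fun setT h.
  apply: measurable_funM; first by apply: measurableT_comp => //; exact: measurable_fst.
  have mb : measurable_fun setT (fun b : bool => (b == a)%:R : R) by [].
  exact: (measurableT_comp mb measurable_snd).
have : (\int[P]_w (k (Z w) * r (Z w))%:E =
        \int[P]_w (k (Z w) * (mu a (Z w) * p (Z w)))%:E)%E.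
  have mEA := measurableI _ _ mE mAa.
  rewrite -(integral_cond_prob mEA Er mk); last exact: (integrable_cond_prob mEA Er mk).2.
  transitivity (\int[P]_w (h (ZAf w) * \1_E w)%:E)%E.
    apply: eq_integral => w _; rewrite /h/= -mulrA; congr (_ * _)%:E.
    rewrite !indicE in_setI (_ : (w \in A @^-1` [set a]) = (A w == a)).
      by case: (w \in E); case: (A w == a); rewrite /= ?mulr1 ?mulr0.
    by apply/idP/eqP; rewrite inE.
  have Emu' : is_cond_prob P ZAf E (fun z => mu z.2 z.1) by [].
  have mmuA : measurable_fun setT (fun w => mu (A w) (Z w)).
    by apply: (@measurableT_comp _ _ _ _ _ _ (fun z => mu z.2 z.1) _ ZAf).
  rewrite (integral_cond_prob mE Emu' mh); last first.
    apply/(integrable_cond_prob mE Emu' mh); apply: bnd => [|w].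
      by apply: measurable_funM => //; exact: (measurableT_comp mh).
    rewrite !normrM !mulr_ile1// ?mulr_ge0//.
      by case: (_ == _); rewrite ?normr1 ?normr0.
    by have := mu01 (Z w, A w); rewrite ler_norml/=; lra.
  transitivity (\int[P]_w ((k \* mu a) (Z w) * \1_(A @^-1` [set a]) w)%:E)%E.
    apply: eq_integral => w _; rewrite /h/= indicE.
    rewrite (_ : (w \in A @^-1` [set a]) = (A w == a)).
      by case: eqP => [->|_]; rewrite ?mulr1 ?mulr0 ?mul0r.
    by apply/idP/eqP; rewrite inE.
  have mkm : measurable_fun setT (k \* mu a) by exact: measurable_funM.
  rewrite (integral_cond_prob mAa Ap mkm).
    by apply: eq_integral => w _; rewrite /= mulrA.
  apply/(integrable_cond_prob mAa Ap mkm).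
  by apply: eq_integrable intmp => // w _; rewrite /= mulrA.
move=> kr; have : {ae P, forall w, k (Z w) ^+ 2 = 0}.
  apply: ge0_integral_eq0_ae => [|w|]; last 1 first.
  - transitivity (\int[P]_w
        ((k (Z w) * (mu a (Z w) * p (Z w)))%:E - (k (Z w) * r (Z w))%:E))%E.
      by apply: eq_integral => w _; rewrite -EFinB -mulrBr -expr2.
    by rewrite integralB_EFin// kr subee//; exact: integrable_fin_num.
  - exact: measurable_funX.
  - exact: sqr_ge0.
by apply: filterS => w /eqP; rewrite sqrf_eq0 subr_eq0 => /eqP.
Qed.

End versions.

(** * Integration against the law of the observed data *)

Section law.
Context {d d' : measure_display} {Omega : measurableType d}
  {T : measurableType d'} {R : realType}.
Variables (P : probability Omega R) (nu : {measure set T -> \bar R}).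
Variables (X : {mfun Omega >-> T}) (fX : T -> R).
Hypotheses (mfX : measurable_fun setT fX) (fX0 : forall x, 0 <= fX x).
Hypothesis fX_density : forall B : set T, measurable B ->
  P (X @^-1` B) = (\int[nu]_(x in B) (fX x)%:E)%E.

Lemma integrable_law (h : T -> R) : measurable_fun setT h ->
  P.-integrable setT (fun w => (h (X w))%:E) <->
  nu.-integrable setT (fun x => (h x * fX x)%:E).
Proof.
move=> mh; apply: iff_trans; first by apply: iff_sym; exact: integrable_pushforwardP.
exact: (@integrable_density _ _ _ (pushforward P X) nu _ mfX fX0 fX_density h mh).
Qed.

Lemma integral_law (h : T -> R) : measurable_fun setT h ->
  P.-integrable setT (fun w => (h (X w))%:E) ->
  (\int[P]_w (h (X w))%:E = \int[nu]_x (h x * fX x)%:E)%E.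
Proof.
move=> mh ih; rewrite -(@integral_density _ _ _ (pushforward P X) nu _ mfX fX0 fX_density h mh).
rewrite (@integral_pushforward _ _ _ _ _ _ _ _ setT)//.
exact/measurable_EFinP.
Qed.

Lemma integrable_event_law (E : set Omega) (q h : T -> R) : measurable E ->
  is_cond_prob P X E q -> measurable_fun setT h ->
  P.-integrable setT (fun w => (h (X w) * \1_E w)%:E) <->
  nu.-integrable setT (fun x => (h x * (q x * fX x))%:E).
Proof.
move=> mE Eq mh; have [mq _ _] := Eq.
apply: iff_trans; first exact: (integrable_cond_prob mE Eq mh).
have mhq : measurable_fun setT (h \* q) by exact: measurable_funM.
rewrite (_ : (fun x => _) = (fun x => ((h \* q) x * fX x)%:E)).
  exact: integrable_law mhq.
by apply/funext => x; rewrite /= mulrA.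
Qed.

Lemma integral_event_law (E : set Omega) (q h : T -> R) : measurable E ->
  is_cond_prob P X E q -> measurable_fun setT h ->
  P.-integrable setT (fun w => (h (X w) * \1_E w)%:E) ->
  (\int[P]_w (h (X w) * \1_E w)%:E = \int[nu]_x (h x * (q x * fX x))%:E)%E.
Proof.
move=> mE Eq mh ih; have [mq _ _] := Eq.
rewrite (integral_cond_prob mE Eq mh ih).
rewrite (@integral_law (h \* q)); first by apply: eq_integral => x _; rewrite /= mulrA.
  exact: measurable_funM.
exact: (integrable_cond_prob mE Eq mh).1.
Qed.

(** P(X in N) = 0 says that [fX] has integral zero over N, so [fX] vanishes almost everywhere on N.
    Almost sure statements about X thus pass to [nu] only on the support of [fX]. *)
Lemma ae_law (N : set T) : measurable N -> {ae P, forall w, ~ N (X w)} ->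
  {ae nu, forall x, 0 < fX x -> ~ N x}.
Proof.
move=> mN PN.
have mXN : measurable (X @^-1` N) by rewrite -[_ @^-1` _]setTI; exact: measurable_funP.
have PN0 : P (X @^-1` N) = 0%E.
  case: PN => N' [mN' N'0 NN']; apply: (subset_measure0 _ _ _ N'0) => //.
  by move=> w Nw; apply: NN' => /(_ Nw).
have : {ae nu, forall x, fX x * \1_N x = 0}.
  apply: ge0_integral_eq0_ae => [|x|].
  - by apply: measurable_funM => //; exact: measurable_indic.
  - exact: mulr_ge0.
  - rewrite -PN0 fX_density// [RHS]integral_mkcond; apply: eq_integral => x _.
    by rewrite patchE indicE; case: ifP; rewrite ?mulr1 ?mulr0.
apply: filterS => x + fx Nx; rewrite indicE mem_set// mulr1 => fx0.
by rewrite fx0 ltxx in fx.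
Qed.

Variables (A Y : {mfun Omega >-> bool}).
Variable p : bool -> bool -> T -> R.
Hypothesis YA_law : forall y a,
  is_cond_prob P X (Y @^-1` [set y] `&` A @^-1` [set a]) (p y a).

Let mE y a : measurable (Y @^-1` [set y] `&` A @^-1` [set a]).
Proof.
by apply: measurableI; rewrite -[_ @^-1` _]setTI; exact: measurable_funP.
Qed.

(** Since (Y, A) takes four values, a function of the data is a sum over four events on each of
    which only X still varies; [integral_event_law] treats each of them. *)
Let at_dataE (psi : bool -> bool -> T -> R) w : at_data X A Y psi w =
  \sum_(y : bool) \sum_(a : bool)
    psi y a (X w) * \1_(Y @^-1` [set y] `&` A @^-1` [set a]) w.
Proof.
have E y a : (\1_(Y @^-1` [set y] `&` A @^-1` [set a]) w : R) =
    ((Y w == y) && (A w == a))%:R.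
  by rewrite indicE; congr (_ %:R); congr nat_of_bool; apply/idP/andP;
    rewrite inE/= => -[/eqP ? /eqP ?].
rewrite /at_data !big_bool !E.
by case: (Y w); case: (A w); rewrite /= ?mulr1 ?mulr0 ?addr0 ?add0r.
Qed.

Lemma measurable_at_data (psi : bool -> bool -> T -> R) :
  (forall y a, measurable_fun setT (psi y a)) ->
  measurable_fun setT (at_data X A Y psi).
Proof.
move=> mpsi; rewrite (funext (at_dataE psi)).
apply: measurable_sum => y; apply: measurable_sum => a.
apply: measurable_funM; last exact: measurable_indic.
exact: measurableT_comp.
Qed.

Lemma integrable_at_data (psi : bool -> bool -> T -> R) :
  (forall y a, measurable_fun setT (psi y a)) ->
  P.-integrable setT (EFin \o at_data X A Y psi) <->
  forall y a, nu.-integrable setT (fun x => (psi y a x * (p y a x * fX x))%:E).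
Proof.
move=> mpsi; split=> [ipsi y a|ipsi].
  apply/(integrable_event_law (mE y a) (YA_law y a) (mpsi y a)).
  apply: le_integrable ipsi => //.
    apply/measurable_EFinP; apply: measurable_funM; last exact: measurable_indic.
    exact: measurableT_comp.
  move=> w _; rewrite lee_fin /at_data indicE.
  case: (boolP (w \in _)) => [|_]; last by rewrite mulr0 normr0.
  by rewrite inE/= => -[-> ->]; rewrite mulr1.
have ie y a : P.-integrable setT (fun w =>
    (psi y a (X w) * \1_(Y @^-1` [set y] `&` A @^-1` [set a]) w)%:E).
  exact: (integrable_event_law (mE y a) (YA_law y a) (mpsi y a)).2.
have := integrable_sum measurableT (index_enum bool) (P := predT)
  (fun y _ => integrable_sum measurableT (index_enum bool) (P := predT) (fun a _ => ie y a)).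
apply: eq_integrable => // w _; rewrite /= at_dataE -sumEFin.
by apply: eq_bigr => y _; rewrite -sumEFin.
Qed.

Lemma integral_at_data (psi : bool -> bool -> T -> R) :
  (forall y a, measurable_fun setT (psi y a)) ->
  P.-integrable setT (EFin \o at_data X A Y psi) ->
  ('E_P[at_data X A Y psi] = \int[nu]_x
    (\sum_(y : bool) \sum_(a : bool) psi y a x * (p y a x * fX x))%:E)%E.
Proof.
move=> mpsi /(integrable_at_data mpsi) ipsi.
have ie y a := (integrable_event_law (mE y a) (YA_law y a) (mpsi y a)).2 (ipsi y a).
rewrite unlock; transitivity (\int[P]_w \sum_(y : bool) \sum_(a : bool)
    (psi y a (X w) * \1_(Y @^-1` [set y] `&` A @^-1` [set a]) w)%:E)%E.
  apply: eq_integral => w _; rewrite /= at_dataE -sumEFin.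
  by apply: eq_bigr => y _; rewrite -sumEFin.
transitivity (\int[nu]_x \sum_(y : bool) \sum_(a : bool)
    (psi y a x * (p y a x * fX x))%:E)%E; last first.
  apply: eq_integral => w _; rewrite /= -sumEFin.
  by apply: eq_bigr => y _; rewrite -sumEFin.
rewrite integral_sum//; last by move=> y; apply: integrable_sum => // a _; exact: ie.
rewrite integral_sum//; last by move=> y; apply: integrable_sum => // a _; exact: ipsi.
apply: eq_bigr => y _; rewrite !integral_sum//; apply: eq_bigr => a _.
exact: integral_event_law.
Qed.

End law.

(** * Directional derivatives *)

Section directional_derivative.
Context {R : realType}.

(** The two difference quotients are the same function. One-variable theorems thereby apply to the
    directional derivatives in which submodels are stated. *)
Lemma is_derive_line {V W : normedModType R} (f : V -> W) (x v : V) (t : R)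
    (df : W) :
  is_derive t 1 (fun h => f (h *: v + x)) df <-> is_derive (t *: v + x) v f df.
Proof.
suff E : (fun h => h^-1 *: ((fun h => f (h *: v + x)) (h *: (1:R) + t) - f (t *: v + x))) =
    (fun h => h^-1 *: (f (h *: v + (t *: v + x)) - f (t *: v + x))).
  split=> -[D1 D2]; split.
  - by move: D1; rewrite /derivable [X in cvg (X @ _)]E.
  - by rewrite -D2 /derive E.
  - by rewrite /derivable [X in cvg (X @ _)]E.
  - by rewrite -D2 /derive E.
by apply/funext => h; rewrite /= scalerDl addrA [h *: 1]mulr1.
Qed.

Lemma is_derive_line0 {V W : normedModType R} (f : V -> W) (x v : V) (df : W) :
  is_derive (0 : R) 1 (fun h => f (h *: v + x)) df <-> is_derive x v f df.
Proof. by have := is_derive_line f x v 0 df; rewrite scale0r add0r. Qed.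

Lemma open_line {V : normedModType R} (U : set V) (x v : V) : open U -> U x ->
  exists2 r : R, 0 < r & forall h : R, h \in `]- r, r[ -> U (h *: v + x).
Proof.
move=> oU Ux.
have cl : (fun h : R => h *: v + x) @ (0 : R) --> 0 *: v + x.
  by apply: cvgD; [apply: cvgZr_tmp; exact: cvg_id|exact: cvg_cst].
have : \forall h \near (0 : R), U (h *: v + x).
  by apply: cl; apply: open_nbhs_nbhs; split => //; rewrite scale0r add0r.
move=> /nbhs_ballP[r/= r0 rU]; exists r => // h hr; apply: rU.
by rewrite /ball/= sub0r normrN ltr_norml; move: hr; rewrite in_itv.
Qed.

(** Serves two purposes: a function constant on the parameter set has zero derivative, and so has a
    nonnegative density at a parameter where it vanishes. *)
Lemma derive_at_min {V : normedModType R} (U : set V) (f : V -> R) (x v : V) :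
  open U -> U x -> (forall t, U t -> derivable f t v) ->
  (forall t, U t -> f x <= f t) -> 'D_v f x = 0.
Proof.
move=> oU Ux df fmin; have [r r0 rU] := open_line v oU Ux.
suff : is_derive (0 : R) (1 : R) (fun h => f (h *: v + x)) 0.
  by move=> /is_derive_line0[].
apply: (@derive1_at_min _ _ (- r) r).
- lra.
- move=> t /rU /df /derivableP dt.
  by have [] := (is_derive_line f x v t ('D_v f (t *: v + x))).2 dt.
- by rewrite in_itv/=; lra.
- by move=> t /rU; rewrite scale0r add0r; exact: fmin.
Qed.

(** On a segment through x in direction v inside U this is one-variable differentiation under the
    integral sign, with the same envelope [H]. *)
Lemma is_derive_integral {d : measure_display} {T : measurableType d}
    {V : normedModType R} (nu : {measure set T -> \bar R}) (U : set V)
    (F : V -> T -> R) (x v : V) (H : T -> R) :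
  open U -> U x ->
  (forall t, U t -> nu.-integrable setT (EFin \o F t)) ->
  (forall t y, U t -> derivable (F^~ y) t v) ->
  nu.-integrable setT (EFin \o H) ->
  (forall t y, U t -> `|'D_v (F^~ y) t| <= H y) ->
  is_derive x v (fun t => \int[nu]_y F t y) (\int[nu]_y 'D_v (F^~ y) x).
Proof.
move=> oU Ux iF dF iH FH; have [r r0 rU] := open_line v oU Ux.
have rU' h : `]- r, r[%classic h -> U (h *: v + x).
  by move=> hr; apply: rU; move: hr; rewrite /= in_itv.
have r00 : `]- r, r[%classic (0 : R) by rewrite /= in_itv/=; lra.
pose f (h : R) y := F (h *: v + x) y.
have line h y : `]- r, r[%classic h -> is_derive h 1 (f^~ y) ('D_v (F^~ y) (h *: v + x)).
  move=> /rU' Uh; apply: (is_derive_line (F^~ y) x v h _).2.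
  exact/derivableP/dF.
have intf h : `]- r, r[%classic h -> nu.-integrable setT (EFin \o f h).
  by move=> /rU' /iF.
have derf h y : `]- r, r[%classic h -> setT y -> derivable (f^~ y) h 1.
  by move=> /(line _ y)[].
have H0 y : 0 <= H y by apply: le_trans (FH _ _ Ux).
have fH h y : `]- r, r[%classic h -> setT y -> `|partial1of2 f h y| <= H y.
  by move=> rh _; rewrite partial1of2E (@derive_val _ _ _ _ _ _ _ (line _ y rh)); apply/FH/rU'.
have D1 := derivable_under_integral measurableT r00 intf derf H0 iH fH.
have D2 := differentiation_under_integral measurableT r00 intf derf H0 iH fH.
apply/is_derive_line0; split; first exact: D1.
rewrite -derive1E D2; apply: eq_Rintegral => y _.
by rewrite partial1of2E (@derive_val _ _ _ _ _ _ _ (line _ y r00)) scale0r add0r.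
Qed.

End directional_derivative.

(** * Regular submodels *)

Lemma integrable_bounded_mul {d : measure_display} {T : measurableType d}
    {R : realType} (m : {measure set T -> \bar R}) (h f : T -> R) (K : R) :
  measurable_fun setT h -> (forall x, `|h x| <= K) ->
  m.-integrable setT (EFin \o f) -> m.-integrable setT (fun x => (h x * f x)%:E).
Proof.
move=> mh hK intf; have := integrableMl measurableT intf mh.
rewrite (_ : (_ \* _)%E = fun x => (h x * f x)%:E); last first.
  by apply/funext => x /=; rewrite -EFinM mulrC.
apply; exists K; split; first exact: num_real.
by move=> x Kx w _; exact: le_trans (hK w) (ltW Kx).
Qed.

Section derivation_rules.
Context {R : realType} {V : normedModType R}.

Lemma is_derive_mul (f g : V -> R) (x v : V) (df dg : R) :
  is_derive x v f df -> is_derive x v g dg ->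
  is_derive x v (fun t => f t * g t) (f x * dg + g x * df).
Proof. exact: is_deriveM. Qed.

Lemma is_derive_comp1 (g : R -> R) (f : V -> R) (x v : V) (dg df : R) :
  is_derive (f x) 1 g dg -> is_derive x v f df ->
  is_derive x v (g \o f) (dg * df).
Proof.
move=> Dg /is_derive_line0 Df; apply/is_derive_line0.
apply: (@is_derive1_comp _ g (fun h => f (h *: v + x))) => //.
by rewrite scale0r add0r.
Qed.

Lemma is_derive_inv (f : V -> R) (x v : V) (df : R) : f x != 0 ->
  is_derive x v f df -> is_derive x v (fun t => (f t)^-1) (- f x ^- 2 * df).
Proof.
move=> fx0; apply: is_derive_comp1; apply: is_derive_eq.
  by apply: (@is_deriveV _ id) => //; exact: is_derive_id.
by rewrite /= [_ *: 1]mulr1.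
Qed.

(** The quotient rule is put in the shape of the influence functions: the factor n / m^2 goes with
    the denominator m, and 1 / m with the numerator n. *)
Lemma is_derive_one_minus_ratio (f g : V -> R) (x v : V) (df dg : R) : g x != 0 ->
  is_derive x v f df -> is_derive x v g dg ->
  is_derive x v (fun t => 1 - f t / g t) (f x / g x ^+ 2 * dg - 1 / g x * df).
Proof.
move=> gx0 Df Dg; have Dfg := is_derive_mul Df (is_derive_inv gx0 Dg).
have D1 := is_deriveB (is_derive_cst (1 : R) x v) Dfg.
by apply: (is_derive_eq D1); rewrite /=; field.
Qed.

End derivation_rules.

Section regular_submodel.
Context {d : measure_display} {T : measurableType d} {R : realType}.
Variables (nu : {measure set T -> \bar R}).
Variables (e : T -> R) (fY : bool -> bool -> T -> R) (fX : T -> R).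
Hypotheses (me : measurable_fun setT e) (e01 : forall x, 0 < e x < 1).
Context {k : nat} (M : submodel R T k).
Hypothesis reg : regular_submodel nu fY fX M.
Variable j : 'I_k.

Local Notation v := (delta_mx 0 j : 'rV[R]_k).
Local Notation t0 := (sub_theta0 M).
Local Notation DY a y x t := ('D_v (fun u => sub_fY M u a y x) t).
Local Notation DX x t := ('D_v (fun u => sub_fX M u x) t).

Let par0 : sub_par M t0 := reg_theta0 reg.

Let is_derive_fY t a y x : sub_par M t ->
  is_derive t v (fun t => sub_fY M t a y x) (DY a y x t).
Proof. by move=> pt; apply/derivableP; exact: (reg_fY_derivable reg). Qed.

Let is_derive_fX t x : sub_par M t ->
  is_derive t v (fun t => sub_fX M t x) (DX x t).
Proof. by move=> pt; apply/derivableP; exact: (reg_fX_derivable reg). Qed.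

Let sub_fY_false t a x : sub_par M t ->
  sub_fY M t a false x = 1 - sub_fY M t a true x.
Proof. by move=> pt; rewrite -(reg_fY_sum1 reg pt a x) big_bool/=; ring. Qed.

Let sub_fY01 t a y x : sub_par M t -> 0 <= sub_fY M t a y x <= 1.
Proof.
move=> pt; have := reg_fY_ge0 reg pt a true x; have := reg_fY_ge0 reg pt a false x.
have := sub_fY_false a x pt.
by case: y; lra.
Qed.

(* D_j of the joint density of (Y^a, X) at the truth *)
Definition joint_derivative (a y : bool) (x : T) : R :=
  fY a y x * DX x t0 + fX x * DY a y x t0.
Local Notation G := joint_derivative.

Let is_derive_joint a y x :
  is_derive t0 v (fun t => sub_fY M t a y x * sub_fX M t x) (G a y x).
Proof.
rewrite /joint_derivative -(reg_fY_true reg) -(reg_fX_true reg).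
by apply: is_derive_mul; [exact: is_derive_fY|exact: is_derive_fX].
Qed.

(** The f_a(y | x) sum to 1 over y, so their derivatives cancel and only D f remains. The right-hand
    side is the same for both values of [a], which yields a linear relation among the four functions
    G. *)
Lemma joint_derivative_sum a x : G a true x + G a false x = DX x t0.
Proof.
have DYF : DY a true x t0 + DY a false x t0 = 0.
  have [D1 D2] : is_derive t0 v
      ((fun t => sub_fY M t a true x) + (fun t => sub_fY M t a false x))
      (DY a true x t0 + DY a false x t0).
    by apply: is_deriveD; exact: is_derive_fY.
  (* The sum is constantly 1 on the parameter set, so the truth is a minimum of it. *)
  rewrite -D2; apply: (derive_at_min (reg_open reg) par0).
    by move=> t pt; apply: derivableD; exact: (reg_fY_derivable reg).
  by move=> t pt; rewrite /= !fctE !sub_fY_false//; lra.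
have := sub_fY_false a x par0; rewrite !(reg_fY_true reg) => fYF.
rewrite /joint_derivative; have -> : DY a false x t0 = - DY a true x t0.
  by apply/eqP; rewrite -addr_eq0 addrC DYF.
by rewrite fYF; ring.
Qed.

(** The joint density is nonnegative on an open parameter set and attains its minimum 0 at the
    truth. *)
Lemma joint_derivative_eq0 a y x : fY a y x * fX x = 0 -> G a y x = 0.
Proof.
move=> f0; rewrite -(@derive_val _ _ _ _ _ _ _ (is_derive_joint a y x)).
apply: (derive_at_min (reg_open reg) par0) => t pt.
  by apply: derivableM; [exact: (reg_fY_derivable reg)|exact: (reg_fX_derivable reg)].
rewrite (reg_fY_true reg) (reg_fX_true reg) f0.
by rewrite mulr_ge0// ?(reg_fY_ge0 reg)// (reg_fX_ge0 reg).
Qed.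

Lemma joint_derivative_bounded : exists2 H : T -> R,
  nu.-integrable setT (EFin \o H) & forall a y x, `|G a y x| <= H x.
Proof.
(* One copy of [H] bounds f_a D f, as f_a <= 1; the other bounds f D f_a. *)
have [H [iH HP]] := reg_dominated reg; exists (fun x => H x + H x).
  exact: (integrableD measurableT iH iH).
move=> a y x; have [HX HY] := HP _ par0 j x.
rewrite /joint_derivative -(reg_fY_true reg) -(reg_fX_true reg).
have /andP[f0 f1] := sub_fY01 a y x par0.
rewrite (le_trans (ler_normD _ _))// lerD//.
  by rewrite normrM ger0_norm// (le_trans _ HX)// ler_piMl.
by rewrite normrM mulrC (ger0_norm (reg_fX_ge0 reg par0 x)); exact: HY.
Qed.

Section derivative_of_integral.
Hypothesis mG : forall a y, measurable_fun setT (G a y).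

(** Measurability of G is a hypothesis here; it is discharged later by writing G as score times
    density. *)
Lemma integrable_joint_derivative a y (h : T -> R) (K : R) :
  measurable_fun setT h -> (forall x, `|h x| <= K) ->
  nu.-integrable setT (fun x => (h x * G a y x)%:E).
Proof.
move=> mh hK; apply: (integrable_bounded_mul mh hK).
have [H iH GH] := joint_derivative_bounded.
apply: le_integrable iH => //; first exact/measurable_EFinP.
by move=> x _; rewrite /= lee_fin (le_trans (GH a y x))// ler_norm.
Qed.

End derivative_of_integral.

Let integrable_sub_fX t (h : T -> R) : sub_par M t -> measurable_fun setT h ->
  (forall x, `|h x| <= 1) -> nu.-integrable setT (fun x => (h x * sub_fX M t x)%:E).
Proof.
move=> pt mh h1; apply: (integrable_bounded_mul mh h1).
apply/integrableP; split; first exact/measurable_EFinP/(reg_fX_meas reg).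
rewrite (eq_integral (fun x => (sub_fX M t x)%:E)).
  by rewrite (reg_fX_int1 reg pt) ltry.
by move=> x _; rewrite /= ger0_norm// (reg_fX_ge0 reg).
Qed.

Let norm_e_mul x b : `|e x * b| <= `|b|.
Proof. by rewrite normrM ler_piMl// ger0_norm; have := e01 x; lra. Qed.

Lemma is_derive_sub_mu a : is_derive t0 v (fun t => sub_mu nu e M t a)
  (\int[nu]_x (e x * G a true x)).
Proof.
have [H [iH HP]] := reg_dominated reg.
have DF t x : sub_par M t -> is_derive t v
    (fun t => sub_fY M t a true x * e x * sub_fX M t x)
    (e x * (sub_fY M t a true x * DX x t + sub_fX M t x * DY a true x t)).
  move=> pt; have D1 := is_derive_mul (is_derive_fY a true x pt) (is_derive_cst (e x) t v).
  by apply: (is_derive_eq (is_derive_mul D1 (is_derive_fX x pt))); rewrite /=; ring.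
apply: is_derive_eq.
  apply: (@is_derive_integral _ _ _ _ nu _ _ _ v (fun x => H x + H x) (reg_open reg) par0).
  - move=> t pt; apply: integrable_sub_fX => //.
      by apply: measurable_funM => //; exact: (reg_fY_meas reg).
    move=> x; have /andP[? ?] := sub_fY01 a true x pt; have /andP[? ?] := e01 x.
    by rewrite normrM !ger0_norm// ?mulr_ile1// ltW.
  - by move=> t x pt; have [] := DF t x pt.
  - exact: (integrableD measurableT iH iH).
  - move=> t x pt; rewrite (@derive_val _ _ _ _ _ _ _ (DF t x pt)).
    have [HX HY] := HP _ pt j x; have /andP[f0 f1] := sub_fY01 a true x pt.
    rewrite (le_trans (norm_e_mul _ _))//.
    rewrite (le_trans (ler_normD _ _))// lerD//.
      by rewrite normrM ger0_norm// (le_trans _ HX)// ler_piMl.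
    by rewrite normrM mulrC (ger0_norm (reg_fX_ge0 reg pt x)); exact: HY.
apply: eq_Rintegral => x _; rewrite (@derive_val _ _ _ _ _ _ _ (DF t0 x par0)).
by rewrite /joint_derivative (reg_fY_true reg) (reg_fX_true reg).
Qed.

(** The derivative of f_1 f_0 f is expressed through G alone: f_0 G_1 + f_1 G_0 counts f_1 f_0 D f
    twice, and the last term removes one copy, with D f written as a sum of two G's. *)
Lemma is_derive_sub_mu_prod : is_derive t0 v (fun t => sub_mu_prod nu e M t)
  (\int[nu]_x (e x * (fY false true x * G true true x +
     fY true true x * G false true x -
     fY true true x * fY false true x * (G true true x + G true false x)))).
Proof.
have [H [iH HP]] := reg_dominated reg.
have DF t x : sub_par M t -> is_derive t v
    (fun t => sub_fY M t true true x * sub_fY M t false true x * e x * sub_fX M t x)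
    (e x * (sub_fY M t true true x * sub_fY M t false true x * DX x t +
     sub_fY M t false true x * (sub_fX M t x * DY true true x t) +
     sub_fY M t true true x * (sub_fX M t x * DY false true x t))).
  move=> pt; have D1 := is_derive_mul
    (is_derive_mul (is_derive_fY true true x pt) (is_derive_fY false true x pt))
    (is_derive_cst (e x) t v).
  by apply: (is_derive_eq (is_derive_mul D1 (is_derive_fX x pt))); rewrite /=; ring.
apply: is_derive_eq.
  (* One copy of [H] for each of the three factors that depend on the parameter. *)
  apply: (@is_derive_integral _ _ _ _ nu _ _ _ v (fun x => H x + H x + H x) (reg_open reg) par0).
  - move=> t pt; apply: integrable_sub_fX => //.
      by do 2 apply: measurable_funM => //; exact: (reg_fY_meas reg).
    move=> x; have /andP[? ?] := sub_fY01 true true x pt.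
    have /andP[? ?] := sub_fY01 false true x pt; have /andP[? ?] := e01 x.
    by rewrite !normrM !ger0_norm ?mulr_ile1 ?mulr_ge0// ltW.
  - by move=> t x pt; have [] := DF t x pt.
  - exact: (integrableD measurableT (integrableD measurableT iH iH) iH).
  - move=> t x pt; rewrite (@derive_val _ _ _ _ _ _ _ (DF t x pt)).
    have [HX HY] := HP _ pt j x; have /andP[f0 f1] := sub_fY01 true true x pt.
    have /andP[g0 g1] := sub_fY01 false true x pt.
    rewrite (le_trans (norm_e_mul _ _))//.
    have HY' a : `|sub_fX M t x * DY a true x t| <= H x.
      by rewrite normrM mulrC (ger0_norm (reg_fX_ge0 reg pt x)); exact: HY.
    rewrite (le_trans (ler_normD _ _))// lerD//; last first.
      by rewrite normrM ger0_norm// (le_trans _ (HY' false))// ler_piMl.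
    rewrite (le_trans (ler_normD _ _))// lerD//; last first.
      by rewrite normrM ger0_norm// (le_trans _ (HY' true))// ler_piMl.
    by rewrite normrM ger0_norm ?mulr_ge0// (le_trans _ HX)// ler_piMl// mulr_ile1.
apply: eq_Rintegral => x _; rewrite (@derive_val _ _ _ _ _ _ _ (DF t0 x par0)).
by rewrite joint_derivative_sum /joint_derivative !(reg_fY_true reg) (reg_fX_true reg); ring.
Qed.

Definition cause_prob (a : bool) (x : T) : R := if a then e x else 1 - e x.

Lemma cause_prob_gt0 a x : 0 < cause_prob a x.
Proof. by rewrite /cause_prob; case: a; have := e01 x; lra. Qed.

Lemma obs_densityE t y a x : obs_density e M t y a x =
  cause_prob a x * (sub_fY M t a y x * sub_fX M t x).
Proof.
rewrite /obs_density /cause_prob.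
by case: a; rewrite /= ?subn0 ?subnn ?expr1 ?expr0; ring.
Qed.

(** Where the density is positive, the score is its logarithmic derivative, and the factor c_a
    cancels because it does not depend on the parameter. Elsewhere the value of the score is
    arbitrary, but both sides are zero. *)
Lemma score_joint_derivative {d' : measure_display} {Omega : measurableType d'}
    (P : probability Omega R) (X : Omega -> T) (A Y : Omega -> bool)
    (s : 'I_k -> bool -> bool -> T -> R) : is_score P X A Y e M s ->
  forall y a x, s j y a x * (fY a y x * fX x) = G a y x.
Proof.
move=> sc y a x; have [f0|f0] := eqVneq (fY a y x * fX x) 0.
  by rewrite f0 mulr0 joint_derivative_eq0.
have c0 := cause_prob_gt0 a x.
have f_gt0 : 0 < fY a y x * fX x.
  rewrite lt_neqAle eq_sym f0/= -(reg_fY_true reg) -(reg_fX_true reg).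
  by rewrite mulr_ge0// ?(reg_fY_ge0 reg)// (reg_fX_ge0 reg).
have obs_true : obs_density e M t0 y a x = cause_prob a x * (fY a y x * fX x).
  by rewrite obs_densityE (reg_fY_true reg) (reg_fX_true reg).
have obs_gt0 : 0 < obs_density e M t0 y a x by rewrite obs_true mulr_gt0.
have [_ <-] := score_derive sc j obs_gt0.
have Dobs : is_derive t0 v (fun t => obs_density e M t y a x) (cause_prob a x * G a y x).
  rewrite (funext (fun t => obs_densityE t y a x)).
  have D := is_derive_mul (is_derive_cst (cause_prob a x) t0 v) (is_derive_joint a y x).
  by apply: (is_derive_eq D); rewrite /= mulr0 addr0.
have Dln := @is_derive_comp1 _ _ _ (fun t => obs_density e M t y a x) t0 v _ _
  (is_derive1_ln obs_gt0) Dobs.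
rewrite (@derive_val _ _ _ _ _ _ _ Dln) obs_true.
by move: f0; rewrite mulf_eq0 negb_or => /andP[fy0 fx0]; field; rewrite fy0 fx0 gt_eqF.
Qed.

End regular_submodel.

(** |t| <= 1 + t^2 <= 1 + u <= exp(u). *)
Lemma damped_le1 {R : realType} (t u : R) : t ^+ 2 <= u -> `|t * expR (- u)| <= 1.
Proof.
move=> tu; rewrite normrM (ger0_norm (expR_ge0 _)) expRN ler_pdivrMr ?expR_gt0//.
rewrite mul1r (le_trans _ (expR_ge1Dx u))//; rewrite ler_norml; nra.
Qed.

(** * Bounded tilts of the true law as regular submodels *)

Section tilted_submodel.
Context {d d' : measure_display} {Omega : measurableType d}
  {T : measurableType d'} {R : realType}.
Variables (P : probability Omega R) (nu : {measure set T -> \bar R}).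
Variables (X : {mfun Omega >-> T}) (A Y : {mfun Omega >-> bool}).
Variables (e : T -> R) (fY : bool -> bool -> T -> R) (fX : T -> R).
Hypotheses (mfX : measurable_fun setT fX) (fX0 : forall x, 0 <= fX x).
Hypothesis fX_int1 : (\int[nu]_x (fX x)%:E = 1)%E.
Hypotheses (mfY : forall a y, measurable_fun setT (fY a y))
  (fY01 : forall a y x, 0 <= fY a y x <= 1)
  (fY_sum1 : forall a x, \sum_(y : bool) fY a y x = 1).

Variables (b : bool -> bool -> T -> R) (c : T -> R).
Hypotheses (mb : forall a y, measurable_fun setT (b a y))
  (b1 : forall a y x, `|b a y x| <= 1)
  (b_centered : forall a x, \sum_(y : bool) b a y x * fY a y x = 0).
Hypotheses (mc : measurable_fun setT c) (c2 : forall x, `|c x| <= 2)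
  (c_centered : (\int[nu]_x (c x * fX x)%:E = 0)%E).

(** The tilt is linear, so that the centering of [b] and [c] preserves total mass exactly at every
    parameter. With |b| <= 1 and |c| <= 2, the radius 1/4 keeps both factors between 1/2 and 3/2,
    hence the densities nonnegative for parameters of either sign. *)
Definition tilt : submodel R T 1 := Submodel
  [set t : 'rV[R]_1 | `|t 0 0| < 4^-1] 0
  (fun t a y x => fY a y x * (1 + t 0 0 * b a y x))
  (fun t x => fX x * (1 + t 0 0 * c x)).

Let is_derive_tilt (C B : R) (j : 'I_1) (t : 'rV[R]_1) :
  is_derive t (delta_mx 0 j) (fun t : 'rV[R]_1 => C * (1 + t 0 0 * B)) (C * B).
Proof.
apply/is_derive_line0; rewrite (_ : (fun h : R => _) =
    (fun h : R => (C * B) * h + C * (1 + t 0 0 * B))); last first.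
  by apply/funext => h; rewrite !mxE ord1 eqxx/=; ring.
have D := is_deriveD
  (is_derive_mul (is_derive_cst (C * B) (0 : R) (1 : R)) (is_derive_id (0 : R) (1 : R)))
  (is_derive_cst (C * (1 + t 0 0 * B)) (0 : R) (1 : R)).
by apply: (is_derive_eq D); rewrite /=; ring.
Qed.

Let tilt_factor_bound (u B : R) : `|u| < 4^-1 -> `|B| <= 2 -> 0 <= 1 + u * B <= 2.
Proof.
move=> u4 B2; have : `|u * B| <= 4^-1 * 2 by rewrite normrM ler_pM// ltW.
by rewrite ler_norml; lra.
Qed.

Let ifX : nu.-integrable setT (EFin \o fX).
Proof.
apply/integrableP; split; first exact/measurable_EFinP.
rewrite (eq_integral (fun x => (fX x)%:E)) ?fX_int1 ?ltry// => x _.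
by rewrite /= ger0_norm.
Qed.

Lemma tilt_regular : regular_submodel nu fY fX tilt.
Proof.
have b2 a y x : `|b a y x| <= 2 by rewrite (le_trans (b1 _ _ _))// ler1n.
split=> /=.
- apply: (@open_comp _ _ (fun t : 'rV[R]_1 => `|t 0 0|) [set u | u < 4^-1]) => //.
  move=> t _; apply: (@continuous_comp _ _ _ (fun t : 'rV[R]_1 => t 0 0) Num.norm).
    exact: coord_continuous.
  exact: norm_continuous.
- by rewrite mxE normr0 invr_gt0.
- move=> t _ a y; apply: measurable_funM => //; apply: measurable_funD => //.
  exact: measurable_funM.
- move=> t pt a y x; have /andP[f0 _] := fY01 a y x.
  by have /andP[? _] := tilt_factor_bound pt (b2 a y x); rewrite mulr_ge0.
- move=> t pt a x; have := fY_sum1 a x; have := b_centered a x; rewrite !big_bool/= => H1 H2.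
  transitivity ((fY a true x + fY a false x) +
    t 0 0 * (b a true x * fY a true x + b a false x * fY a false x)); first by ring.
  by rewrite H1 H2 mulr0 addr0.
- move=> t _; apply: measurable_funM => //; apply: measurable_funD => //.
  exact: measurable_funM.
- move=> t pt x; have /andP[? _] := tilt_factor_bound pt (c2 x); exact: mulr_ge0.
- move=> t pt; have icf := integrable_bounded_mul mc c2 ifX.
  pose g x := t 0 0 * (c x * fX x).
  transitivity (\int[nu]_x ((EFin \o fX) x + (EFin \o g) x))%E.
    by apply: eq_integral => x _; rewrite /= -EFinD; congr (_%:E); rewrite /g; ring.
  have itcf : nu.-integrable setT (EFin \o g).
    exact: (integrableZl measurableT (t 0 0) icf).
  rewrite integralD_EFin// fX_int1.
  under eq_integral do rewrite /= EFinM.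
  by rewrite integralZl// c_centered mule0 adde0.
- by move=> a y x; rewrite mxE mul0r addr0 mulr1.
- by move=> x; rewrite mxE mul0r addr0 mulr1.
- by move=> t pt j a y x; have [] := is_derive_tilt (fY a y x) (b a y x) j t.
- by move=> t pt j x; have [] := is_derive_tilt (fX x) (c x) j t.
(* |D f| = f |c| <= 2 f, and |D f_a| <= 1 is multiplied by a tilted density of X that is at most 2
   f. *)
- exists (fun x => 2 * fX x); split; first exact: (integrableZl measurableT 2 ifX).
  move=> t pt j x; split.
    rewrite (@derive_val _ _ _ _ _ _ _ (is_derive_tilt (fX x) (c x) j t)).
    by rewrite normrM (ger0_norm (fX0 x)) mulrC ler_wpM2r.
  move=> a y; rewrite (@derive_val _ _ _ _ _ _ _ (is_derive_tilt (fY a y x) (b a y x) j t)).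
  have /andP[g0 g2] := tilt_factor_bound pt (c2 x).
  have : `|fY a y x * b a y x| <= 1.
    by rewrite normrM mulr_ile1//; have := fY01 a y x; rewrite ler_norml; lra.
  move=> fb; rewrite mulrCA [leRHS]mulrC; apply: ler_wpM2l => //.
  by rewrite -[leRHS]mul1r ler_pM.
Qed.

Lemma tilt_score : is_score P X A Y e tilt (fun _ y a x => b a y x + c x).
Proof.
split.
- by move=> j y a; exact: measurable_funD.
- move=> j y a x obs0.
  have := is_derive_mul (is_derive_cst (cause_prob e a x) (0 : 'rV[R]_1) (delta_mx 0 j))
    (is_derive_mul (is_derive_tilt (fY a y x) (b a y x) j 0) (is_derive_tilt (fX x) (c x) j 0)).
  rewrite -(funext (fun t => obs_densityE e tilt t y a x)) => Dobs.
  have Dln := @is_derive_comp1 _ _ _ (fun t => obs_density e tilt t y a x) 0 _ _ _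
    (is_derive1_ln obs0) Dobs.
  apply: (is_derive_eq Dln).
  move: obs0; rewrite obs_densityE /= !mxE !mul0r !addr0 !mulr1 => /lt0r_neq0.
  rewrite !mulf_eq0 !negb_or => /andP[c0 /andP[fy0 fx0]].
  by field; rewrite c0 fy0 fx0.
(* The score b + c is at most 1 + 2 in absolute value, whence the bound 9 on its square. *)
- move=> j; apply: (@bounded_integrable _ _ _ _ _ 9).
    apply: measurable_funX; apply: measurable_at_data => y a.
    exact: measurable_funD.
  move=> w; rewrite /at_data normrX.
  have : `|b (A w) (Y w) (X w) + c (X w)| <= 3.
    rewrite (le_trans (ler_normD _ _))//.
    by rewrite (le_trans (lerD (b1 _ _ _) (c2 _)))//; lra.
  move=> h3; rewrite (_ : 9 = 3 ^+ 2); last by ring.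
  by rewrite lerXn2r// nnegrE.
Qed.

End tilted_submodel.

(** * Influence functions *)

Section influence_functions.
Context {d d' : measure_display} {Omega : measurableType d}
  {T : measurableType d'} {R : realType}.
Variables (P : probability Omega R) (nu : {measure set T -> \bar R}).
Variables (X : {mfun Omega >-> T}) (A Y : {mfun Omega >-> bool}).
Variables (e : T -> R) (fY : bool -> bool -> T -> R) (fX : T -> R).
Hypotheses (mfX : measurable_fun setT fX) (fX0 : forall x, 0 <= fX x).
Hypothesis fX_density : forall B : set T, measurable B ->
  P (X @^-1` B) = (\int[nu]_(x in B) (fX x)%:E)%E.
Hypotheses (me : measurable_fun setT e) (e01 : forall x, 0 < e x < 1).
Hypotheses (mfY : forall a y, measurable_fun setT (fY a y))
  (fY01 : forall a y x, 0 <= fY a y x <= 1)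
  (fY_sum1 : forall a x, \sum_(y : bool) fY a y x = 1).
Hypothesis YA_law : forall y a,
  is_cond_prob P X (Y @^-1` [set y] `&` A @^-1` [set a])
    (fun x => fY a y x * cause_prob e a x).

Let integrable_dataP psi mpsi := @integrable_at_data _ _ _ _ _ _ _ X fX mfX fX0
  fX_density A Y _ YA_law psi mpsi.
Let integral_dataP psi mpsi := @integral_at_data _ _ _ _ _ _ _ X fX mfX fX0
  fX_density A Y _ YA_law psi mpsi.

Let measurable_cause_prob a : measurable_fun setT (cause_prob e a).
Proof. by rewrite /cause_prob; case: a => //; exact: measurable_funB. Qed.

Let ifX1 : (\int[nu]_x (fX x)%:E = 1)%E.
Proof. by rewrite -(fX_density measurableT) preimage_setT probability_setT. Qed.

Let ifX : nu.-integrable setT (EFin \o fX).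
Proof.
apply/integrableP; split; first exact/measurable_EFinP.
rewrite (eq_integral (fun x => (fX x)%:E)) ?ifX1 ?ltry// => x _.
by rewrite /= ger0_norm.
Qed.

Lemma integrable_at_data_bounded (psi : bool -> bool -> T -> R) (K : R) :
  (forall y a, measurable_fun setT (psi y a)) ->
  (forall y a x, `|psi y a x * cause_prob e a x| <= K) ->
  P.-integrable setT (EFin \o at_data X A Y psi).
Proof.
move=> mpsi psiK; apply/(integrable_dataP mpsi) => y a.
have m1 : measurable_fun setT (fun x => psi y a x * cause_prob e a x * fY a y x).
  by apply: measurable_funM => //; exact: measurable_funM.
have b1 x : `|psi y a x * cause_prob e a x * fY a y x| <= K.
  rewrite normrM (le_trans _ (psiK y a x))// ler_piMr//.
  by have := fY01 a y x; rewrite ler_norml; lra.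
apply: eq_integrable (integrable_bounded_mul m1 b1 ifX) => // x _.
by congr (_%:E); ring.
Qed.

(* Cross terms vanish because the conditional scores are centered. *)
Let centered_product (s b f : bool -> R) (r c : R) :
  \sum_(y : bool) f y = 1 -> \sum_(y : bool) s y * f y = 0 ->
  \sum_(y : bool) b y * f y = 0 ->
  \sum_(y : bool) (s y + r) * (b y + c) * f y =
  \sum_(y : bool) s y * b y * f y + r * c.
Proof.
rewrite !big_bool/= => f1 s0 b0.
transitivity (s true * b true * f true + s false * b false * f false
  + c * (s true * f true + s false * f false)
  + r * (b true * f true + b false * f false)
  + r * c * (f true + f false)); first by ring.
by rewrite f1 s0 b0; ring.
Qed.

(** Given X, the outcome components average to zero under each f_a, and the component in x
    integrates to zero. The mean of a candidate thus follows from tangency. *)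
Lemma tangent_mean0 (psi : bool -> bool -> T -> R) :
  (forall y a, measurable_fun setT (psi y a)) ->
  P.-integrable setT (EFin \o at_data X A Y psi) ->
  in_tangent_space nu fY fX psi -> ('E_P[at_data X A Y psi] = 0)%E.
Proof.
move=> mpsi ipsi [s_ [s [[ms_ ms] s_0 [isf sf0] psiE]]].
rewrite (integral_dataP mpsi ipsi).
have mE y a x : psi y a x = (if a then s_ true y x else s_ false y x) + s x.
  by rewrite psiE; case: a; rewrite /= ?subrr ?subr0 ?mul1r ?mul0r ?addr0 ?add0r.
rewrite (@ae_eq_integral _ _ _ _ _ (fun x => (s x * fX x)%:E))//.
- move: sf0; rewrite /Rintegral => /eqP.
  by rewrite fine_eq0 ?(integrable_fin_num measurableT isf)// => /eqP.
- apply/measurable_EFinP; apply: measurable_sum => y; apply: measurable_sum => a.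
  by apply: measurable_funM => //; apply: measurable_funM => //; exact: measurable_funM.
- by apply/measurable_EFinP; exact: measurable_funM.
- apply: filterS2 (s_0 true) (s_0 false) => x st sf _; congr (_%:E).
  have [->|fx0] := eqVneq (fX x) 0.
    by rewrite mulr0 big1// => y _; rewrite big1// => a _; rewrite !mulr0.
  have {}fx0 : 0 < fX x by rewrite lt_neqAle eq_sym fx0 fX0.
  have {}st := st fx0; have {}sf := sf fx0.
  have ft := fY_sum1 true x; have ff := fY_sum1 false x.
  rewrite !big_bool/= !mE/= /cause_prob; move: st sf ft ff; rewrite !big_bool/= => st sf ft ff.
  transitivity (fX x * (
    e x * (s_ true true x * fY true true x + s_ true false x * fY true false x) +
    (1 - e x) *
      (s_ false true x * fY false true x + s_ false false x * fY false false x) +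
    s x * (e x * (fY true true x + fY true false x) +
      (1 - e x) * (fY false true x + fY false false x)))); first by ring.
  by rewrite st sf ft ff; ring.
Qed.

(** The density c_a f_a f is split between the two factors: psi takes c_a and becomes bounded, the
    score takes f_a f and becomes the dominated function G. *)
Lemma score_product_integral (k : nat) (M : submodel R T k)
    (s : 'I_k -> bool -> bool -> T -> R) (j : 'I_k)
    (psi : bool -> bool -> T -> R) (K : R) :
  regular_submodel nu fY fX M -> is_score P X A Y e M s ->
  (forall y a, measurable_fun setT (psi y a)) ->
  (forall y a x, `|psi y a x * cause_prob e a x| <= K) ->
  P.-integrable setT (fun w => (at_data X A Y psi w * at_data X A Y (s j) w)%:E) /\
  ('E_P[(fun w => at_data X A Y psi w * at_data X A Y (s j) w)%R] =
   \int[nu]_x (\sum_(y : bool) \sum_(a : bool)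
     psi y a x * cause_prob e a x * joint_derivative fY fX M j a y x)%:E)%E.
Proof.
move=> reg sc mpsi psiK.
have sG := score_joint_derivative e01 reg j sc.
have mG a y : measurable_fun setT (joint_derivative fY fX M j a y).
  rewrite -(funext (sG y a)); apply: measurable_funM; first exact: (score_meas sc).
  exact: measurable_funM.
have mps y a : measurable_fun setT (fun x => psi y a x * s j y a x).
  by apply: measurable_funM => //; exact: (score_meas sc).
have E y a x : psi y a x * s j y a x * (fY a y x * cause_prob e a x * fX x) =
    psi y a x * cause_prob e a x * joint_derivative fY fX M j a y x.
  by rewrite -sG; ring.
have int : P.-integrable setT
    (EFin \o at_data X A Y (fun y a x => psi y a x * s j y a x)).
  apply/(integrable_dataP mps) => y a.
  have m1 : measurable_fun setT (fun x => psi y a x * cause_prob e a x).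
    exact: measurable_funM.
  have := integrable_joint_derivative reg mG a y m1 (psiK y a).
  by apply: eq_integrable => // x _; rewrite E.
split; first exact: int.
rewrite (integral_dataP mps int); apply: eq_integral => x _; congr (_%:E).
by apply: eq_bigr => y _; apply: eq_bigr => a _; rewrite E.
Qed.

(** Both estimands are 1 - numerator / mu_1. What depends on the estimand is isolated in the last
    premise: the derivative of the numerator as an integral of some N, and a pointwise identity that
    compares N with psi c_a G. *)
Lemma influence_one_minus_ratio
    (numer : forall k, submodel R T k -> 'rV[R]_k -> R)
    (psi : bool -> bool -> T -> R) (K n m : R) : m != 0 ->
  (forall y a, measurable_fun setT (psi y a)) ->
  (forall y a x, `|psi y a x * cause_prob e a x| <= K) ->
  in_tangent_space nu fY fX psi ->
  (forall k (M : submodel R T k), regular_submodel nu fY fX M ->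
    numer k M (sub_theta0 M) = n /\ sub_mu nu e M (sub_theta0 M) true = m) ->
  (forall k (M : submodel R T k) (j : 'I_k), regular_submodel nu fY fX M ->
    (forall a y, measurable_fun setT (joint_derivative fY fX M j a y)) ->
    exists N : T -> R, [/\ nu.-integrable setT (EFin \o N),
      is_derive (sub_theta0 M) (delta_mx 0 j) (numer k M) (\int[nu]_x N x) &
      {ae nu, forall x, \sum_(y : bool) \sum_(a : bool)
          psi y a x * cause_prob e a x * joint_derivative fY fX M j a y x =
        n / m ^+ 2 * (e x * joint_derivative fY fX M j true true x) -
        1 / m * N x}]) ->
  is_influence_in_tangent P nu X A Y e fY fX
    (fun k M t => 1 - numer k M t / sub_mu nu e M t true) psi.
Proof.
move=> m0 mpsi psiK tpsi true_val HN; split => //.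
have ipsi := integrable_at_data_bounded mpsi psiK.
split => //; first exact: tangent_mean0.
move=> k M s reg sc j; have [int E] := score_product_integral j reg sc mpsi psiK.
split; first exact: int.
have sG := score_joint_derivative e01 reg j sc.
have mG a y : measurable_fun setT (joint_derivative fY fX M j a y).
  rewrite -(funext (sG y a)); apply: measurable_funM; first exact: (score_meas sc).
  exact: measurable_funM.
have [N [iN DN NE]] := HN k M j reg mG; have [nE mE] := true_val k M reg.
have Dm := is_derive_sub_mu me e01 reg j true.
have m0' : sub_mu nu e M (sub_theta0 M) true != 0 by rewrite mE.
apply: (is_derive_eq (is_derive_one_minus_ratio m0' DN Dm)).
rewrite nE mE E.
have e1 x : `|e x| <= 1 by have := e01 x; rewrite ler_norml; lra.
have iG : nu.-integrable setT (fun x => (e x * joint_derivative fY fX M j true true x)%:E).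
  exact: (integrable_joint_derivative reg mG true true me e1).
rewrite (@ae_eq_integral _ _ _ _ _ (fun x =>
   (n / m ^+ 2 * (e x * joint_derivative fY fX M j true true x) -
    1 / m * N x)%:E))//; last 3 first.
- apply/measurable_EFinP; apply: measurable_sum => y; apply: measurable_sum => a.
  by apply: measurable_funM => //; exact: measurable_funM.
- apply/measurable_EFinP; apply: measurable_funB; apply: measurable_funM => //.
    exact: measurable_funM.
  by apply/measurable_EFinP; case/integrableP : iN.
- by apply: filterS NE => x -> _.
rewrite -RintegralZl// -RintegralZl// -RintegralB//.
- exact: (integrableZl measurableT (n / m ^+ 2) iG).
- exact: (integrableZl measurableT (1 / m) iN).
Qed.

(* Both influence functions have the same inner product with the score of every
   tilted submodel; tilting along a damped version of their difference forces
   that difference to vanish. *)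
Lemma influence_in_tangent_unique
    (beta_ : forall k, submodel R T k -> 'rV[R]_k -> R)
    (psi psi' : bool -> bool -> T -> R) :
  is_influence_in_tangent P nu X A Y e fY fX beta_ psi ->
  is_influence_in_tangent P nu X A Y e fY fX beta_ psi' ->
  {ae P, forall w, at_data X A Y psi' w = at_data X A Y psi w}.
Proof.
move=> [[mpsi ipsi _ Dpsi] [s_ [s [[ms_ ms] s_0 [is_ s0] psiE]]]].
move=> [[mpsi' ipsi' _ Dpsi'] [s_' [s' [[ms_' ms'] s_0' [is_' s0'] psiE']]]].
pose t a y x := s_' a y x - s_ a y x; pose r x := s' x - s x.
pose delta y a x := psi' y a x - psi y a x.
have deltaE y a x : delta y a x = t a y x + r x.
  by rewrite /delta psiE psiE' /t /r; case: a; rewrite /= ?subrr ?subr0; ring.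
have mt a y : measurable_fun setT (t a y) by exact: measurable_funB.
have mr : measurable_fun setT r by exact: measurable_funB.
have mdelta y a : measurable_fun setT (delta y a) by exact: measurable_funB.
have irf : nu.-integrable setT (EFin \o (fun x => r x * fX x)).
  apply: eq_integrable (integrableB measurableT is_' is_) => // x _.
  by rewrite /= /r mulrBl.
have r0 : (\int[nu]_x (r x * fX x)%:E = 0)%E.
  transitivity (\int[nu]_x ((s' x * fX x)%:E - (s x * fX x)%:E))%E.
    by apply: eq_integral => x _; rewrite -EFinB /r mulrBl.
  have z (g : T -> R) : nu.-integrable setT (EFin \o g) -> \int[nu]_x g x = 0 ->
      (\int[nu]_x (g x)%:E = 0)%E.
    move=> ig /eqP; rewrite /Rintegral fine_eq0 => [/eqP//|].
    exact: integrable_fin_num.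
  by rewrite integralB_EFin// (z _ is_ s0) (z _ is_' s0') sube0.
have t0 a : {ae nu, forall x, 0 < fX x -> \sum_(y : bool) t a y x * fY a y x = 0}.
  apply: filterS2 (s_0 a) (s_0' a) => x h h' fx.
  transitivity (\sum_(y : bool) s_' a y x * fY a y x - \sum_(y : bool) s_ a y x * fY a y x).
    by rewrite -sumrB; apply: eq_bigr => y _; rewrite /t mulrBl.
  by rewrite h// h'// subrr.
(* [t] is centered only almost everywhere on the support, while regularity of the tilt requires
   normalization at every x; the indicator sets [b] to zero where centering fails. *)
pose rho a x := (\sum_(y : bool) t a y x * fY a y x == 0)%:R *
  expR (- (t a true x ^+ 2 + t a false x ^+ 2)).
have mrho a : measurable_fun setT (rho a).
  apply: measurable_funM.
    apply: (@measurableT_comp _ _ _ _ _ _ (fun b : bool => b%:R : R)) => //.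
    apply: measurable_fun_eqr => //; apply: measurable_sum => y.
    exact: measurable_funM.
  apply: measurableT_comp => //; apply: measurable_funN.
  by apply: measurable_funD; exact: measurable_funX.
have rho0 a x : 0 <= rho a x by rewrite mulr_ge0// expR_ge0.
pose b a y x := t a y x * rho a x.
have mb a y : measurable_fun setT (b a y) by exact: measurable_funM.
have b1 a y x : `|b a y x| <= 1.
  rewrite /b /rho mulrCA; case: (_ == _); last by rewrite mul0r normr0.
  rewrite mul1r damped_le1//.
  by case: y; rewrite ?lerDl ?lerDr sqr_ge0.
have b0 a x : \sum_(y : bool) b a y x * fY a y x = 0.
  rewrite (eq_bigr (fun y => rho a x * (t a y x * fY a y x))); last first.
    by move=> y _; rewrite /b; ring.
  rewrite -mulr_sumr /rho; case: eqP => [->|_]; first by rewrite mulr0.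
  by rewrite !mul0r.
pose c0 x := r x * expR (- (r x ^+ 2)).
have mexp : measurable_fun setT (fun x => expR (- (r x ^+ 2))).
  apply: measurableT_comp => //; apply: measurable_funN.
  exact: measurable_funX.
have mc0 : measurable_fun setT c0 by exact: measurable_funM.
have c01 x : `|c0 x| <= 1 by exact: damped_le1.
have ic0 := integrable_bounded_mul mc0 c01 ifX.
(* Subtracting the mean of [c0] centers [c] and costs the bound 2. In the inner product it only
   contributes a multiple of the mean of [r], which is zero. *)
pose kappa := \int[nu]_x (c0 x * fX x).
have kappaE : (\int[nu]_x (c0 x * fX x)%:E = kappa%:E)%E.
  by rewrite /kappa /Rintegral fineK//; exact: integrable_fin_num.
have kappa1 : `|kappa| <= 1.
  rewrite (le_trans (le_normr_Rintegral _ ic0))//.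
  rewrite (_ : 1 = \int[nu]_x fX x); last by rewrite /Rintegral ifX1.
  apply: le_Rintegral => //.
    by apply: integrable_norm; exact: ic0.
  by move=> x _; rewrite normrM (ger0_norm (fX0 x)) ler_piMl.
pose c x := c0 x - kappa.
have mc : measurable_fun setT c by exact: measurable_funB.
have c2 x : `|c x| <= 2.
  by rewrite (le_trans (ler_normB _ _))// (le_trans (lerD (c01 x) kappa1)).
have ikf : nu.-integrable setT (EFin \o (fun x => kappa * fX x)).
  exact: (integrableZl measurableT kappa ifX).
have c_int0 : (\int[nu]_x (c x * fX x)%:E = 0)%E.
  transitivity (\int[nu]_x ((c0 x * fX x)%:E - (kappa * fX x)%:E))%E.
    by apply: eq_integral => x _; rewrite -EFinB /c mulrBl.
  rewrite integralB_EFin// kappaE; under [X in (_ - X)%E]eq_integral do rewrite EFinM.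
  by rewrite integralZl// ifX1 mule1 subee.
have reg := tilt_regular mfX fX0 ifX1 mfY fY01 fY_sum1 mb b1 b0 mc c2 c_int0.
have sc := tilt_score P X A Y e fY fX mb b1 mc c2.
set S := (fun _ y a x => _) in sc.
have [int D] := Dpsi _ _ _ reg sc ord0; have [int' D'] := Dpsi' _ _ _ reg sc ord0.
(* Both inner products are the derivative of the estimand along the tilt. *)
have EE : ('E_P[(fun w => at_data X A Y psi w * at_data X A Y (S ord0) w)%R] =
    'E_P[(fun w => at_data X A Y psi' w * at_data X A Y (S ord0) w)%R])%E.
  have := @derive_val _ _ _ _ _ _ _ D; rewrite (@derive_val _ _ _ _ _ _ _ D').
  rewrite unlock => h.
  rewrite -(fineK (integrable_fin_num measurableT int)).
  by rewrite -(fineK (integrable_fin_num measurableT int')) h.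
pose Q x := \sum_(y : bool) \sum_(a : bool)
  delta y a x * (b a y x + c x) * (fY a y x * cause_prob e a x * fX x).
have mdS y a : measurable_fun setT (fun x => delta y a x * (b a y x + c x)).
  by apply: measurable_funM => //; exact: measurable_funD.
have idS : P.-integrable setT
    (EFin \o at_data X A Y (fun y a x => delta y a x * (b a y x + c x))).
  apply: eq_integrable (integrableB measurableT int' int) => // w _.
  by rewrite /= /at_data /delta /S -EFinB mulrBl.
have iQ0 : (\int[nu]_x (Q x)%:E = 0)%E.
  rewrite -(integral_dataP mdS idS) unlock.
  transitivity (\int[P]_w ((at_data X A Y psi' w * at_data X A Y (S ord0) w)%:E -
      (at_data X A Y psi w * at_data X A Y (S ord0) w)%:E))%E.
    by apply: eq_integral => w _; rewrite /= /at_data /delta /S -EFinB mulrBl.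
  rewrite integralB_EFin//; move: EE; rewrite unlock => ->.
  by rewrite subee//; exact: (integrable_fin_num measurableT int').
have iQ : nu.-integrable setT (EFin \o Q).
  have := (integrable_dataP mdS).1 idS => iya.
  have := integrable_sum measurableT (index_enum bool) (P := predT)
    (fun y _ => integrable_sum measurableT (index_enum bool) (P := predT) (fun a _ => iya y a)).
  apply: eq_integrable => // x _; rewrite /= -sumEFin.
  by apply: eq_bigr => y _; rewrite -sumEFin.
(* The quadratic form left after the cross terms cancel. [G] times [fX] differs from the integrand
   [Q] of the inner product by [kappa * (r x * fX x)], which integrates to zero. *)
pose G x := \sum_(a : bool) cause_prob e a x *
    (\sum_(y : bool) t a y x * b a y x * fY a y x) + r x * c0 x.
have mG : measurable_fun setT G.
  apply: measurable_funD; last exact: measurable_funM.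
  apply: measurable_sum => a; apply: measurable_funM => //.
  apply: measurable_sum => y; apply: measurable_funM => //.
  exact: measurable_funM.
have tb0 a y x : 0 <= t a y x * b a y x * fY a y x.
  have /andP[? _] := fY01 a y x.
  by rewrite mulr_ge0// /b mulrA -expr2 mulr_ge0// sqr_ge0.
have rc0 x : 0 <= r x * c0 x by rewrite /c0 mulrA -expr2 mulr_ge0// ?sqr_ge0 ?expR_ge0.
have cp0 a x : 0 < cause_prob e a x by exact: cause_prob_gt0.
have G0 x : 0 <= G x.
  rewrite addr_ge0// sumr_ge0// => a _.
  by apply: mulr_ge0; [exact: ltW|exact: sumr_ge0].
have QE : {ae nu, forall x, Q x + kappa * (r x * fX x) = G x * fX x}.
  apply: filterS2 (t0 true) (t0 false) => x h1 h2.
  have [fx0|fx0] := eqVneq (fX x) 0.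
    by rewrite /Q fx0 !mulr0 addr0 big1// => y _; rewrite big1// => a _; rewrite !mulr0.
  have fx : 0 < fX x by rewrite lt_neqAle eq_sym fx0 fX0.
  have ta a : \sum_(y : bool) t a y x * fY a y x = 0.
    by case: a; [exact: h1|exact: h2].
  have C a := centered_product (s := fun y => t a y x) (b := fun y => b a y x)
    (f := fun y => fY a y x) (r x) (c x) (fY_sum1 a x) (ta a) (b0 a x).
  rewrite /Q exchange_big/= (eq_bigr (fun a => fX x * (cause_prob e a x *
    (\sum_(y : bool) (t a y x + r x) * (b a y x + c x) * fY a y x)))); last first.
    by move=> a _; rewrite !mulr_sumr; apply: eq_bigr => y _; rewrite deltaE; ring.
  rewrite -mulr_sumr (eq_bigr (fun a => cause_prob e a x *
    (\sum_(y : bool) t a y x * b a y x * fY a y x) + cause_prob e a x * (r x * c x))); last first.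
    by move=> a _; rewrite C mulrDr.
  have cp1 : \sum_(a : bool) cause_prob e a x = 1 by rewrite big_bool/= /cause_prob; ring.
  rewrite big_split/= /G -mulr_suml cp1.
  by rewrite /c; ring.
have iG0 : (\int[nu]_x (G x * fX x)%:E = 0)%E.
  have ikr : nu.-integrable setT (EFin \o (fun x => kappa * (r x * fX x))).
    exact: (integrableZl measurableT kappa irf).
  have mQ : measurable_fun setT Q.
    by apply/measurable_EFinP; case/integrableP : iQ.
  rewrite -(@ae_eq_integral _ _ _ _ _ _ (fun x => (Q x + kappa * (r x * fX x))%:E))//.
  - transitivity (\int[nu]_x ((EFin \o Q) x + (EFin \o (fun x => (kappa * (r x * fX x))%R)) x))%E.
      by apply: eq_integral.
    rewrite integralD_EFin// iQ0 add0e.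
    by under eq_integral do rewrite /= EFinM; rewrite integralZl// r0 mule0.
  - apply/measurable_EFinP; apply: measurable_funD => //.
    by apply: measurable_funM => //; exact: measurable_funM.
  - by apply/measurable_EFinP; exact: measurable_funM.
  - by apply: filterS QE => x -> _.
have {}iG0 : {ae nu, forall x, G x * fX x = 0}.
  apply: ge0_integral_eq0_ae iG0; first exact: measurable_funM.
  by move=> x; rewrite mulr_ge0.
(* Only the product with [fY] is claimed to vanish: where [fY] is zero, the quadratic form gives no
   control of [t]. Such values of the data have probability zero. *)
have delta0 : {ae nu, forall x, 0 < fX x -> forall y a, delta y a x * fY a y x = 0}.
  apply: filterS3 iG0 (t0 true) (t0 false) => x + h1 h2 fx y a.
  have ta : \sum_(y : bool) t a y x * fY a y x = 0.
    by case: (a); [exact: h1|exact: h2].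
  move=> /eqP; rewrite mulf_eq0 (gt_eqF fx) orbF /G paddr_eq0//; last first.
    by apply: sumr_ge0 => a' _; apply: mulr_ge0; [exact: ltW|exact: sumr_ge0].
  move=> /andP[/eqP tz /eqP rz].
  have {}rz : r x = 0.
    move: rz; rewrite /c0 mulrA -expr2 => /eqP.
    by rewrite mulf_eq0 sqrf_eq0 (gt_eqF (expR_gt0 _)) orbF => /eqP.
  have : cause_prob e a x * (\sum_(y : bool) t a y x * b a y x * fY a y x) = 0.
    move: tz => /psumr_eq0P -> // a' _.
    by apply: mulr_ge0; [exact: ltW|exact: sumr_ge0].
  move=> /eqP; rewrite mulf_eq0 (gt_eqF (cp0 a x))/= => /eqP/psumr_eq0P.
  move=> /(_ (fun y _ => tb0 a y x) y erefl) tby.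
  rewrite deltaE rz addr0; move: tby; rewrite /b /rho ta eqxx mul1r => /eqP.
  rewrite !mulf_eq0 (gt_eqF (expR_gt0 _)) orbF orbb.
  by move=> /orP[] /eqP ->; rewrite ?mul0r ?mulr0.
have idelta : P.-integrable setT (EFin \o at_data X A Y delta).
  exact: (integrableB measurableT ipsi' ipsi).
(* The integral of |delta| against the density of the data carries the conclusion from [nu] to
   [P]. *)
have : {ae P, forall w, `|at_data X A Y delta w| = 0}.
  pose ndelta y a x := `|delta y a x|.
  have mnd y a : measurable_fun setT (ndelta y a) by exact: measurableT_comp.
  have ind : P.-integrable setT (EFin \o at_data X A Y ndelta).
    exact: (integrable_norm idelta).
  apply: ge0_integral_eq0_ae => [|//|].
    by apply: measurableT_comp => //; exact: measurable_at_data.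
  have := integral_dataP mnd ind; rewrite unlock => ->.
  rewrite (@ae_eq_integral _ _ _ _ _ (cst 0%E))//; first by rewrite integral0.
    apply/measurable_EFinP; apply: measurable_sum => y; apply: measurable_sum => a.
    by apply: measurable_funM => //; apply: measurable_funM => //; exact: measurable_funM.
  apply: filterS delta0 => x h _; congr (_%:E); rewrite big1// => y _; rewrite big1// => a _.
  have [->|fx0] := eqVneq (fX x) 0; first by rewrite !mulr0.
  have fx : 0 < fX x by rewrite lt_neqAle eq_sym fx0 fX0.
  have : `|delta y a x * fY a y x| = 0 by rewrite h// normr0.
  rewrite normrM (ger0_norm (andP (fY01 a y x)).1) /ndelta => z.
  by rewrite !mulrA z !mul0r.
by apply: filterS => w /eqP; rewrite normr_eq0 /at_data /delta subr_eq0 => /eqP.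
Qed.

End influence_functions.

(** * Probability of necessary causation *)

Section necessary_causation.
Context {d d' : measure_display} {Omega : measurableType d}
  {T : measurableType d'} {R : realType}.
Variables (P : probability Omega R) (nu : {measure set T -> \bar R}).
Variables (X : {mfun Omega >-> T}) (A Y Y0 Y1 : {mfun Omega >-> bool}).
Hypothesis consistency : forall w,
  (Y w : nat) = (A w * Y1 w + (1 - A w) * Y0 w)%N.
Variables (fX : T -> R) (fY : bool -> bool -> T -> R) (e : T -> R)
  (mu : bool -> T -> R).
Hypotheses (mfX : measurable_fun setT fX) (fX0 : forall x, 0 <= fX x).
Hypothesis fX_density : forall B : set T, measurable B ->
  P (X @^-1` B) = (\int[nu]_(x in B) (fX x)%:E)%E.
Hypothesis fY_sum1 : forall a x, \sum_(y : bool) fY a y x = 1.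
Hypothesis fY0_density : forall y, is_cond_prob P X [set w | Y0 w = y] (fY false y).
Hypothesis fY1_density : forall y, is_cond_prob P X [set w | Y1 w = y] (fY true y).
Hypothesis propensity : is_cond_prob P X [set w | A w = true] e.
Hypothesis regression : is_cond_prob P (fun w => (X w, A w)) [set w | Y w = true]
  (fun z => mu z.2 z.1).
Hypothesis AY_gt0 : (0 < P [set w | A w = true /\ Y w = true])%E.
Hypothesis ignorability : cond_indep P X (fun w => (Y0 w, Y1 w)) A.
Hypothesis e01 : forall x, 0 < e x < 1.

Local Notation Ya a := (if a then Y1 else Y0).
Local Notation mu0 := (mu_const P X e mu false).
Local Notation mu1 := (mu_const P X e mu true).
Local Notation mu01 := (mu_const_prod P X e mu).

Let me : measurable_fun setT e. Proof. by have [] := propensity. Qed.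

Let fY_density a y : is_cond_prob P X (Ya a @^-1` [set y]) (fY a y).
Proof. by case: a; [exact: fY1_density|exact: fY0_density]. Qed.

Let mfY a y : measurable_fun setT (fY a y).
Proof. by have [] := fY_density a y. Qed.

Let fY01 a y x : 0 <= fY a y x <= 1.
Proof. by have [] := fY_density a y. Qed.

Let fYF a x : fY a false x = 1 - fY a true x.
Proof. by rewrite -(fY_sum1 a x) big_bool/=; ring. Qed.

Let mmu a : measurable_fun setT (mu a).
Proof.
have [mmu _ _] := regression.
rewrite (_ : mu a = (fun z => mu z.2 z.1) \o (fun z => (z, a)))//.
by apply: measurableT_comp => //; exact: measurable_pair2.
Qed.

Let mu_01 a x : 0 <= mu a x <= 1.
Proof. by have [_ /(_ (x, a))] := regression. Qed.

Let mev (B : {mfun Omega >-> bool}) b : measurable (B @^-1` [set b]).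
Proof. by rewrite -[_ @^-1` _]setTI; exact: measurable_funP. Qed.

Let cause_law a : is_cond_prob P X (A @^-1` [set a]) (cause_prob e a).
Proof.
case: a; first exact: propensity.
rewrite (_ : _ @^-1` _ = ~` (A @^-1` [set true])).
  exact: (is_cond_probC (mev A true) propensity).
by apply/seteqP; split => w /=; case: (A w).
Qed.

Let mY01 : measurable_fun setT (fun w => (Y0 w, Y1 w)).
Proof. exact: measurable_fun_pair. Qed.

Let Y01 : {mfun Omega >-> (bool * bool)%type} :=
  mfun_Sub (mem_set mY01 : (fun w => (Y0 w, Y1 w)) \in mfun).

Let potential_law (C : set (bool * bool)) (q : T -> R) a : measurable C ->
  is_cond_prob P X (Y01 @^-1` C) q ->
  is_cond_prob P X (Y01 @^-1` C `&` A @^-1` [set a])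
    (fun x => q x * cause_prob e a x).
Proof.
move=> mC Cq; have ign : cond_indep P X Y01 A := ignorability.
exact: (cond_indep_cond_prob ign mC _ Cq (cause_law a)).
Qed.

(** Ignorability concerns the pair (Y^0, Y^1); an event of one potential outcome is a cylinder event
    of the pair. *)
Let outcome_law a y b : is_cond_prob P X (Ya a @^-1` [set y] `&` A @^-1` [set b])
  (fun x => fY a y x * cause_prob e b x).
Proof.
pose C : set (bool * bool) := if a then snd @^-1` [set y] else fst @^-1` [set y].
have mC : measurable C.
  rewrite /C; case: (a).
    by rewrite -[_ @^-1` _]setTI; exact: measurable_snd.
  by rewrite -[_ @^-1` _]setTI; exact: measurable_fst.
have EC : Ya a @^-1` [set y] = Y01 @^-1` C by rewrite /C; case: (a).
by rewrite EC; apply: potential_law => //; rewrite -EC.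
Qed.

Let observed_event y a : Y @^-1` [set y] `&` A @^-1` [set a] =
  Ya a @^-1` [set y] `&` A @^-1` [set a].
Proof.
apply/seteqP; split => w /= [+ Aw]; have := consistency w; rewrite Aw;
  by case: (a); case: (Y w); case: (Y0 w); case: (Y1 w).
Qed.

Let YA_law y a : is_cond_prob P X (Y @^-1` [set y] `&` A @^-1` [set a])
  (fun x => fY a y x * cause_prob e a x).
Proof. by rewrite observed_event. Qed.

(** By consistency and ignorability, mu_a c_a and f_a(1 | .) c_a are both the conditional
    probability of Y = 1, A = a; positivity cancels c_a. *)
Let mu_fY_aeP a : {ae P, forall w, mu a (X w) = fY a true (X w)}.
Proof.
have := regression_ae (mev Y true) regression (cause_law a) (YA_law true a).
by apply: filterS => w /mulIf; apply; exact/lt0r_neq0/cause_prob_gt0.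
Qed.

Let mu_fY_ae a : {ae nu, forall x, 0 < fX x -> mu a x = fY a true x}.
Proof.
have mN : measurable [set x | mu a x != fY a true x].
  rewrite (_ : [set x | _] = ~` ((fun x => mu a x == fY a true x) @^-1` [set true])).
    apply: measurableC; rewrite -[_ @^-1` _]setTI.
    exact: (measurable_fun_eqr (mmu a) (mfY a true)).
  by apply/seteqP; split => x /= /negP.
have : {ae P, forall w, ~ [set x | mu a x != fY a true x] (X w)}.
  by apply: filterS (mu_fY_aeP a) => w h /=; rewrite h eqxx.
move=> /(ae_law mfX fX0 fX_density mN); apply: filterS => x h fx.
by apply/eqP; have := h fx => /= /negP; rewrite negbK.
Qed.

Let ler_norm1 (x : R) : 0 <= x <= 1 -> `|x| <= 1.
Proof. by rewrite ler_norml; lra. Qed.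

Let e1 x : `|e x| <= 1.
Proof. by have := e01 x; rewrite ler_norml; lra. Qed.

Let mu_le1 a x : `|mu a x| <= 1. Proof. exact: ler_norm1. Qed.
Let fY_le1 a y x : `|fY a y x| <= 1. Proof. exact: ler_norm1. Qed.

Let bounded_law (h : T -> R) : measurable_fun setT h -> (forall x, `|h x| <= 1) ->
  P.-integrable setT (fun w => (h (X w))%:E) /\
  nu.-integrable setT (fun x => (h x * fX x)%:E) /\
  ('E_P[(fun w => h (X w))%R] = \int[nu]_x (h x * fX x)%:E)%E.
Proof.
move=> mh h1; have ih : P.-integrable setT (fun w => (h (X w))%:E).
  apply: (@bounded_integrable _ _ _ _ (h \o X) 1) => [|w]; last exact: h1.
  exact: measurableT_comp.
split => //; split; first exact: (integrable_law mfX fX0 fX_density mh).1.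
by rewrite unlock; exact: (integral_law mfX fX0 fX_density mh ih).
Qed.

(** * Identification of the probability of necessary causation *)

Let event_expectation (E : set Omega) (q h : T -> R) :
  is_cond_prob P X E q -> measurable_fun setT h ->
  {ae P, forall w, h (X w) = q (X w)} -> ('E_P[(fun w => h (X w))%R] = P E)%E.
Proof.
move=> [mq _ /(_ setT measurableT)]; rewrite preimage_setT setIT => -> mh hq.
rewrite unlock; apply: ae_eq_integral => //.
- by apply/measurable_EFinP; exact: measurableT_comp.
- by apply/measurable_EFinP; exact: measurableT_comp.
- by apply: filterS hq => w -> _.
Qed.

Let mmue a : measurable_fun setT (fun x => mu a x * e x).
Proof. exact: measurable_funM. Qed.

Let mmumue : measurable_fun setT (fun x => mu true x * mu false x * e x).
Proof. by apply: measurable_funM => //; exact: measurable_funM. Qed.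

Let mue1 a x : `|mu a x * e x| <= 1.
Proof. by rewrite normrM mulr_ile1. Qed.

Let mumue1 x : `|mu true x * mu false x * e x| <= 1.
Proof. by rewrite !normrM !mulr_ile1 ?mulr_ge0. Qed.

(** For a = 0 the event is counterfactual: mu_0 is the probability that a treated unit would have
    had the outcome without the cause, jointly with A = 1. For a = 1 it is P(A = 1, Y = 1), whence
    mu_1 > 0. *)
Let mu_constE a : ('E_P[(fun w => mu a (X w) * e (X w))%R] =
  P (Ya a @^-1` [set true] `&` A @^-1` [set true]))%E.
Proof.
apply: (event_expectation (outcome_law a true true) (mmue a)).
by apply: filterS (mu_fY_aeP a) => w ->.
Qed.

Let AYE : [set w | A w = true /\ Y w = true] =
  Y1 @^-1` [set true] `&` A @^-1` [set true].
Proof. by rewrite -(observed_event true true) setIC. Qed.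

Let mu1E : mu1 = fine (P [set w | A w = true /\ Y w = true]).
Proof. by rewrite /mu_const (mu_constE true) AYE. Qed.

Lemma mu_const_true_gt0 : 0 < mu1.
Proof.
rewrite mu1E fine_gt0// AY_gt0/= (le_lt_trans (probability_le1 P _))// ?ltry//.
by rewrite AYE; exact: measurableI.
Qed.

Let mu1_neq0 : mu1 != 0. Proof. exact/lt0r_neq0/mu_const_true_gt0. Qed.

Let fin_numP (S : set Omega) : measurable S -> P S \is a fin_num.
Proof. by move=> mS; exact: fin_num_measure. Qed.

Let numeratorE : [set w | Y0 w = false /\ A w = true /\ Y w = true] =
  (Y1 @^-1` [set true] `&` A @^-1` [set true]) `\` (Y0 @^-1` [set true]).
Proof.
rewrite -AYE; apply/seteqP; split => w /=.
  by move=> [-> [-> ->]]; split.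
by move=> [[-> ->]]; case: (Y0 w) => // /(_ erefl).
Qed.

(** Up to a null set, monotonicity places {Y^0 = 1, A = 1} inside {Y^1 = 1, A = 1}. The event of
    necessary causation is the difference of the two, of probability mu_1 - mu_0. *)
Lemma prob_necessary_causation_monotone :
  {ae P, forall w, (Y0 w <= Y1 w)%N} ->
  prob_necessary_causation P Y0 A Y = 1 - mu0 / mu1.
Proof.
move=> mono; rewrite /prob_necessary_causation -mu1E numeratorE.
set E1 := Y1 @^-1` [set true] `&` A @^-1` [set true].
have mE1 : measurable E1 by exact: measurableI.
have H1 := measureDI P mE1 (mev Y0 true).
have -> : mu0 = fine (P (E1 `&` Y0 @^-1` [set true])).
  rewrite /mu_const (mu_constE false); congr fine.
  set E0 := _ `&` A @^-1` _; have mE0 : measurable E0 by exact: measurableI.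
  rewrite (measureDI P mE0 (mev Y1 true)) [X in (X + _)%E](_ : _ = 0%E).
    rewrite add0e; congr (P _); rewrite /E0 /E1; apply/seteqP.
    by split => w /= [[? ?] ?].
  case: mono => N [mN N0 sub]; apply: (subset_measure0 _ _ _ N0) => //.
    exact: measurableD.
  by move=> w [[/= Y0w _] Y1w]; apply: sub => /=; rewrite Y0w; case: (Y1 w) Y1w.
have -> : mu1 = fine (P E1) by rewrite /mu_const (mu_constE true).
have PE1 : fine (P E1) != 0 by rewrite /E1 -AYE -mu1E.
rewrite (_ : fine (P (E1 `\` _)) = fine (P E1) - fine (P (E1 `&` Y0 @^-1` [set true]))).
  by rewrite mulrBl divff.
rewrite H1 fineD ?addrK//; apply: fin_numP; [exact: measurableD|exact: measurableI].
Qed.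

(** Given X, the event Y^0 = 0, Y^1 = 1, A = 1 has probability (1 - mu_0(X)) mu_1(X) e(X), whose
    mean is mu_1 - mu. *)
Lemma prob_necessary_causation_cond_indep : cond_indep P X Y0 Y1 ->
  prob_necessary_causation P Y0 A Y = 1 - mu01 / mu1.
Proof.
move=> ind; rewrite /prob_necessary_causation -mu1E.
pose C : set (bool * bool) := [set false] `*` [set true].
have mC : measurable C by exact: measurableX.
have EC : Y01 @^-1` C = Y0 @^-1` [set false] `&` Y1 @^-1` [set true] by [].
have L : is_cond_prob P X (Y01 @^-1` C `&` A @^-1` [set true])
    (fun x => fY false false x * fY true true x * cause_prob e true x).
  apply: potential_law => //; rewrite EC.
  exact: (cond_indep_cond_prob ind _ _ (fY_density false false) (fY_density true true)).
have -> : [set w | Y0 w = false /\ A w = true /\ Y w = true] =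
    Y01 @^-1` C `&` A @^-1` [set true].
  rewrite EC -setIA -(observed_event true true); apply/seteqP.
  by split => w /= [? [? ?]].
have mh : measurable_fun setT (fun x => mu true x * e x - mu true x * mu false x * e x).
  exact: measurable_funB.
rewrite -(event_expectation L mh); last first.
  apply: filterS2 (mu_fY_aeP true) (mu_fY_aeP false) => w -> ->.
  by rewrite fYF /cause_prob; ring.
have [i1 _] := bounded_law (mmue true) (mue1 true).
have [i01 _] := bounded_law mmumue mumue1.
rewrite unlock; under eq_integral do rewrite EFinB.
rewrite integralB_EFin// fineB ?(integrable_fin_num measurableT)//.
have -> : mu01 = fine (\int[P]_w (mu true (X w) * mu false (X w) * e (X w))%:E)%E.
  by rewrite /mu_const_prod unlock.
rewrite (_ : fine _ = mu1) ?mulrBl ?divff//.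
by rewrite /mu_const unlock.
Qed.

Let integral_mu_const a : nu.-integrable setT (fun x => (mu a x * e x * fX x)%:E) /\
  \int[nu]_x (mu a x * e x * fX x) = mu_const P X e mu a.
Proof.
have [_ [i E]] := bounded_law (mmue a) (mue1 a).
by split => //; rewrite /mu_const E.
Qed.

Let integral_mu_const_prod :
  nu.-integrable setT (fun x => (mu true x * mu false x * e x * fX x)%:E) /\
  \int[nu]_x (mu true x * mu false x * e x * fX x) = mu01.
Proof.
have [_ [i E]] := bounded_law mmumue mumue1.
by split => //; rewrite /mu_const_prod E.
Qed.

Let ae_Rintegral (f g : T -> R) : measurable_fun setT f -> measurable_fun setT g ->
  {ae nu, forall x, f x = g x} -> \int[nu]_x f x = \int[nu]_x g x.
Proof.
move=> mf mg fg; congr fine; apply: ae_eq_integral => //; try exact/measurable_EFinP.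
by apply: filterS fg => x -> _.
Qed.

Let ae_off_support (f g : T -> R) : {ae nu, forall x, 0 < fX x -> f x = g x} ->
  {ae nu, forall x, f x * fX x = g x * fX x}.
Proof.
apply: filterS => x h; have [->|fx] := eqVneq (fX x) 0; first by rewrite !mulr0.
by rewrite h// lt_neqAle eq_sym fx fX0.
Qed.

Let sub_mu_true k (M : submodel R T k) a : regular_submodel nu fY fX M ->
  sub_mu nu e M (sub_theta0 M) a = mu_const P X e mu a.
Proof.
move=> reg; rewrite -(integral_mu_const a).2 /sub_mu; apply: ae_Rintegral.
- rewrite (_ : (fun x => _) = (fun x => fY a true x * e x * fX x)).
    by apply: measurable_funM => //; exact: measurable_funM.
  by apply/funext => x; rewrite (reg_fY_true reg) (reg_fX_true reg).
- exact: measurable_funM.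
- have : {ae nu, forall x, 0 < fX x -> fY a true x * e x = mu a x * e x}.
    by apply: filterS (mu_fY_ae a) => x h /h ->.
  by move=> /ae_off_support; apply: filterS => x <-; rewrite (reg_fY_true reg) (reg_fX_true reg).
Qed.

Let sub_mu_prod_true k (M : submodel R T k) : regular_submodel nu fY fX M ->
  sub_mu_prod nu e M (sub_theta0 M) = mu01.
Proof.
move=> reg; rewrite -integral_mu_const_prod.2 /sub_mu_prod; apply: ae_Rintegral.
- rewrite (_ : (fun x => _) = (fun x => fY true true x * fY false true x * e x * fX x)).
    by apply: measurable_funM => //; apply: measurable_funM => //; exact: measurable_funM.
  by apply/funext => x; rewrite !(reg_fY_true reg) (reg_fX_true reg).
- exact: measurable_funM.
- have : {ae nu, forall x, 0 < fX x ->
      fY true true x * fY false true x * e x = mu true x * mu false x * e x}.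
    by apply: filterS2 (mu_fY_ae true) (mu_fY_ae false) => x h h' fx; rewrite h ?h'.
  by move=> /ae_off_support; apply: filterS => x <-; rewrite !(reg_fY_true reg) (reg_fX_true reg).
Qed.

(** * Efficiency of the candidate influence functions *)

Let measurable_control_weight : measurable_fun setT (fun x => (1 - e x)^-1).
Proof.
rewrite (_ : (fun x => _) = expR \o (fun x => - ln (1 - e x))).
  apply: measurableT_comp => //; apply: measurable_funN.
  by apply: measurableT_comp; [exact: measurable_ln|exact: measurable_funB].
by apply/funext => x /=; rewrite expRN lnK// posrE; have := e01 x; lra.
Qed.

(* Both candidate influence functions are of the form [weighted u v r]. *)
Let weighted (u v r : T -> R) (y a : bool) (x : T) : R :=
  u x * a%:R * (y%:R - mu true x)
  - e x * v x * ((1 - a%:R) / (1 - e x)) * (y%:R - mu false x) + r x.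

Section weighted.
Variables u v r : T -> R.
Hypotheses (mea_u : measurable_fun setT u) (mea_v : measurable_fun setT v)
  (mea_r : measurable_fun setT r).

Let measurable_weighted y a : measurable_fun setT (weighted u v r y a).
Proof.
apply: measurable_funD => //; apply: measurable_funB.
  by apply: measurable_funM; [exact: measurable_funM|exact: measurable_funB].
apply: measurable_funM; last exact: measurable_funB.
apply: measurable_funM; first exact: measurable_funM.
exact: measurable_funM.
Qed.

(** The inverse weight 1 / (1 - e) occurs only for a = 0, where c_0 = 1 - e cancels it. *)
Let weighted_bounded K : (forall x, `|u x| <= K) -> (forall x, `|v x| <= K) ->
  (forall x, `|r x| <= K) ->
  forall y a x, `|weighted u v r y a x * cause_prob e a x| <= K + K.
Proof.
move=> uK vK rK y a x.
have e0 : 1 - e x != 0 by have := e01 x; lra.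
have c1 : `|cause_prob e a x| <= 1.
  by rewrite /cause_prob; case: (a); have := e01 x; rewrite ler_norml; lra.
have ymu b : `|y%:R - mu b x| <= 1.
  by have := mu_01 b x; rewrite ler_norml; case: (y) => /=; lra.
rewrite /weighted mulrDl (le_trans (ler_normD _ _))// lerD//; last first.
  by rewrite normrM (le_trans _ (rK x))// ler_piMr.
case: (a); rewrite /cause_prob/=.
  rewrite subrr mul0r mulr0 mul0r subr0 mulr1 !normrM (le_trans _ (uK x))//.
  by rewrite -mulrA ler_piMr// mulr_ile1.
rewrite (_ : _ * (1 - e x) = - (v x * (e x * (y%:R - mu false x)))).
  by rewrite normrN !normrM (le_trans _ (vK x))// ler_piMr// mulr_ile1.
by field.
Qed.

(** The residuals y - mu_a(x) are centered under f_a because mu_a(x) = f_a(1 | x) almost everywhere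
    on the support. *)
Let weighted_in_tangent : nu.-integrable setT (fun x => (r x * fX x)%:E) ->
  \int[nu]_x (r x * fX x) = 0 -> in_tangent_space nu fY fX (weighted u v r).
Proof.
move=> ir r0; exists (fun a y x => if a then u x * (y%:R - mu true x)
  else - (e x * v x * (1 - e x)^-1 * (y%:R - mu false x))), r; split => //.
- split => // -[] y; first by apply: measurable_funM => //; exact: measurable_funB.
  apply: measurable_funN; apply: measurable_funM; last exact: measurable_funB.
  by apply: measurable_funM => //; exact: measurable_funM.
- move=> a; apply: filterS (mu_fY_ae a) => x h fx; rewrite big_bool/=.
  by move: (h fx) (fYF a x); case: (a) => /= muE ->; rewrite muE; ring.
- by move=> y a x; rewrite /weighted; case: a => /=; ring.
Qed.

Lemma weighted_efficient (numer : forall k, submodel R T k -> 'rV[R]_k -> R)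
    (K n : R) :
  (forall x, `|u x| <= K) -> (forall x, `|v x| <= K) -> (forall x, `|r x| <= K) ->
  nu.-integrable setT (fun x => (r x * fX x)%:E) -> \int[nu]_x (r x * fX x) = 0 ->
  (forall k (M : submodel R T k), regular_submodel nu fY fX M ->
    numer k M (sub_theta0 M) = n) ->
  (forall k (M : submodel R T k) (j : 'I_k), regular_submodel nu fY fX M ->
    (forall a y, measurable_fun setT (joint_derivative fY fX M j a y)) ->
    exists N : T -> R, [/\ nu.-integrable setT (EFin \o N),
      is_derive (sub_theta0 M) (delta_mx 0 j) (numer k M) (\int[nu]_x N x) &
      {ae nu, forall x, \sum_(y : bool) \sum_(a : bool) weighted u v r y a x *
          cause_prob e a x * joint_derivative fY fX M j a y x =
        n / mu1 ^+ 2 * (e x * joint_derivative fY fX M j true true x) -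
        1 / mu1 * N x}]) ->
  is_efficient_influence_function P nu X A Y e fY fX
    (fun k M t => 1 - numer k M t / sub_mu nu e M t true) (weighted u v r).
Proof.
move=> uK vK rK ir r0 nE HN.
have I : is_influence_in_tangent P nu X A Y e fY fX
    (fun k M t => 1 - numer k M t / sub_mu nu e M t true) (weighted u v r).
  apply: (influence_one_minus_ratio mfX fX0 fX_density me e01 mfY fY01 fY_sum1
    YA_law mu1_neq0 measurable_weighted (weighted_bounded uK vK rK)) HN.
    exact: weighted_in_tangent.
  by move=> k M reg; split; [exact: nE|exact: sub_mu_true].
split=> // psi' I'.
exact: (influence_in_tangent_unique mfX fX0 fX_density me e01 mfY fY01 fY_sum1
  YA_law I I').
Qed.

End weighted.

(** Eliminating one of the four functions G leaves three without a linear relation, so the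
    comparison with the derivative of beta becomes an algebraic identity in them. *)
Let joint_derivative_false k (M : submodel R T k) (j : 'I_k) x :
  regular_submodel nu fY fX M ->
  joint_derivative fY fX M j true false x =
    joint_derivative fY fX M j false true x +
    joint_derivative fY fX M j false false x -
    joint_derivative fY fX M j true true x.
Proof.
move=> reg; rewrite (joint_derivative_sum reg j false) -(joint_derivative_sum reg j true).
by ring.
Qed.

Lemma phi_monotone_efficient :
  is_efficient_influence_function P nu X A Y e fY fX (beta_monotone nu e)
    (phi_monotone e mu mu0 mu1).
Proof.
set q := mu0 / mu1 ^+ 2; set i := mu1^-1.
pose r x := q * (mu true x * e x) - i * (mu false x * e x).
have -> : phi_monotone e mu mu0 mu1 = weighted (cst q) (cst i) r.
  apply/funext => y; apply/funext => a; apply/funext => x.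
  by rewrite /phi_monotone /weighted /r /cst -/q div1r -/i; ring.
have mr : measurable_fun setT r by apply: measurable_funB; exact: measurable_funM.
have [i1 m1] := integral_mu_const true; have [i0 m0] := integral_mu_const false.
have j1 := integrableZl measurableT q i1; have j0 := integrableZl measurableT i i0.
apply: (@weighted_efficient (cst q) (cst i) r _ _ _
  (fun k M t => sub_mu nu e M t false) (`|q| + `|i|) mu0) => //.
- by move=> x; rewrite lerDl.
- by move=> x; rewrite lerDr.
- move=> x; rewrite (le_trans (ler_normB _ _))// !normrM -!normrM.
  by rewrite lerD// normrM ler_piMr.
- apply: eq_integrable (integrableB measurableT j1 j0) => // x _.
  by rewrite /r /=; congr (_%:E); ring.
- transitivity (\int[nu]_x (q * (mu true x * e x * fX x) - i * (mu false x * e x * fX x))).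
    by apply: eq_Rintegral => x _; rewrite /r; ring.
  by rewrite RintegralB// !RintegralZl// m1 m0 /q /i; field.
- by move=> k M reg; exact: sub_mu_true.
- move=> k M j reg mG; exists (fun x => e x * joint_derivative fY fX M j false true x).
  split; first exact: (integrable_joint_derivative reg mG false true me e1).
    exact: is_derive_sub_mu.
  (* The terms in [mu] coming from the residuals cancel against [r], so the identity holds at every
     x, even where [mu] differs from [fY]. *)
  apply: aeW => x; rewrite !big_bool/= joint_derivative_false//.
  rewrite /weighted /cause_prob /r /cst -/q div1r -/i/=.
  by field; have := e01 x; lra.
Qed.

(** The weights follow from the product rule: the derivative of f_1 f_0 is f_0 in the direction of
    f_1 and f_1 in that of f_0, which accounts for mu_0(x) in [u] and mu_1(x) in [v]. *)
Lemma phi_cond_indep_efficient :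
  is_efficient_influence_function P nu X A Y e fY fX (beta_cond_indep nu e)
    (phi_cond_indep e mu mu01 mu1).
Proof.
set q := mu01 / mu1 ^+ 2; set i := mu1^-1.
pose u x := q - i * mu false x; pose v x := i * mu true x.
pose r x := q * (mu true x * e x) - i * (mu true x * mu false x * e x).
have -> : phi_cond_indep e mu mu01 mu1 = weighted u v r.
  apply/funext => y; apply/funext => a; apply/funext => x.
  by rewrite /phi_cond_indep /weighted /r /u /v -/q -/i; ring.
have mea_u : measurable_fun setT u by apply: measurable_funB => //; exact: measurable_funM.
have mea_v : measurable_fun setT v by exact: measurable_funM.
have mea_r : measurable_fun setT r by apply: measurable_funB; exact: measurable_funM.
have [i1 m1] := integral_mu_const true; have [i0 m0] := integral_mu_const_prod.
have j1 := integrableZl measurableT q i1; have j0 := integrableZl measurableT i i0.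
apply: (@weighted_efficient u v r mea_u mea_v mea_r
  (fun k M t => sub_mu_prod nu e M t) (`|q| + `|i|) mu01) => //.
- by move=> x; rewrite (le_trans (ler_normB _ _))// lerD// normrM ler_piMr.
- by move=> x; rewrite normrM (le_trans (ler_piMr _ (mu_le1 _ _)))// lerDr.
- move=> x; rewrite (le_trans (ler_normB _ _))// (normrM q) (normrM i).
  by rewrite lerD// ler_piMr.
- apply: eq_integrable (integrableB measurableT j1 j0) => // x _.
  by rewrite /r /=; congr (_%:E); ring.
- transitivity (\int[nu]_x (q * (mu true x * e x * fX x) -
      i * (mu true x * mu false x * e x * fX x))).
    by apply: eq_Rintegral => x _; rewrite /r; ring.
  by rewrite RintegralB// !RintegralZl// m1 m0 /q /i; field.
- move=> k M j reg mG.
  set G := joint_derivative fY fX M j.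
  exists (fun x => e x * (fY false true x * G true true x +
     fY true true x * G false true x -
     fY true true x * fY false true x * (G true true x + G true false x))).
  split; last 2 first.
  + exact: is_derive_sub_mu_prod.
  + apply: filterS2 (mu_fY_ae true) (mu_fY_ae false) => x h1 h0.
    (* The derivative of the numerator involves [fY], the candidate [mu]. Off the support every G is
       zero; on it the two agree almost everywhere. *)
    have [fx0|fx0] := eqVneq (fX x) 0.
      have G0 a y : G a y x = 0 by apply: (joint_derivative_eq0 reg); rewrite fx0 mulr0.
      rewrite !G0 big1; last by move=> y _; rewrite big1// => a _; rewrite -/G G0 mulr0.
      by ring.
    have fx : 0 < fX x by rewrite lt_neqAle eq_sym fx0 fX0.
    rewrite -h1// -h0// !big_bool/= /G joint_derivative_false//.
    rewrite /weighted /cause_prob /r /u /v -/q div1r -/i/=.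
    by field; have := e01 x; lra.
  have b1 : nu.-integrable setT (fun x => (e x * fY false true x * G true true x)%:E).
    apply: (integrable_joint_derivative reg mG true true (K := 1)).
      exact: measurable_funM.
    by move=> x; rewrite normrM mulr_ile1.
  have b2 : nu.-integrable setT (fun x => (e x * fY true true x * G false true x)%:E).
    apply: (integrable_joint_derivative reg mG false true (K := 1)).
      exact: measurable_funM.
    by move=> x; rewrite normrM mulr_ile1.
  have b3 y : nu.-integrable setT
      (fun x => (e x * fY true true x * fY false true x * G true y x)%:E).
    apply: (integrable_joint_derivative reg mG true y (K := 1)).
      by apply: measurable_funM => //; exact: measurable_funM.
    by move=> x; rewrite !normrM !mulr_ile1// mulr_ge0.
  have := integrableB measurableT (integrableD measurableT b1 b2)
    (integrableD measurableT (b3 true) (b3 false)).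
  by apply: eq_integrable => // x _; rewrite /=; congr (_%:E); ring.
Qed.

End necessary_causation.

Theorem theorem2 (R : realType) (p : nat) (d : measure_display)
  (Omega : measurableType d) (P : probability Omega R)
  (X : {mfun Omega >-> p.-tuple R}) (A Y Y0 Y1 : {mfun Omega >-> bool})
  (consistency : forall w,
     (Y w : nat) = (A w * Y1 w + (1 - A w) * Y0 w)%N)
  (nu : {sigma_finite_measure set (p.-tuple R) -> \bar R})
  (fX : p.-tuple R -> R)
  (fX_meas : measurable_fun setT fX) (fX_ge0 : forall x, 0 <= fX x)
  (fX_density : forall B : set (p.-tuple R), measurable B ->
     P (X @^-1` B) = (\int[nu]_(x in B) (fX x)%:E)%E)
  (fY : bool -> bool -> p.-tuple R -> R)
  (fY_sum1 : forall a x, \sum_(y : bool) fY a y x = 1)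
  (fY0_density : forall y, is_cond_prob P X [set w | Y0 w = y] (fY false y))
  (fY1_density : forall y, is_cond_prob P X [set w | Y1 w = y] (fY true y))
  (e : p.-tuple R -> R)
  (propensity : is_cond_prob P X [set w | A w = true] e)
  (mu : bool -> p.-tuple R -> R)
  (regression : is_cond_prob P (fun w => (X w, A w)) [set w | Y w = true]
     (fun z => mu z.2 z.1))
  (AY_gt0 : (0 < P [set w | A w = true /\ Y w = true])%E)
  (ignorability : cond_indep P X (fun w => (Y0 w, Y1 w)) A)
  (positivity : forall x, 0 < e x < 1) :
  let beta := prob_necessary_causation P Y0 A Y in
  let mu0 := mu_const P X e mu false in
  let mu1 := mu_const P X e mu true in
  let mu01 := mu_const_prod P X e mu in
  ({ae P, forall w, (Y0 w <= Y1 w)%N} ->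
     let phi := phi_monotone e mu mu0 mu1 in
     [/\ beta = 1 - mu0 / mu1,
         is_efficient_influence_function P nu X A Y e fY fX
           (beta_monotone nu e) phi,
         forall y a x, phi y a x = phi_monotone_beta e mu beta mu1 y a x &
         is_efficiency_bound P nu X A Y e fY fX
           (beta_monotone nu e) ('V_P[at_data X A Y phi])%E])
  /\
  (cond_indep P X Y0 Y1 ->
     let phi := phi_cond_indep e mu mu01 mu1 in
     [/\ beta = 1 - mu01 / mu1,
         is_efficient_influence_function P nu X A Y e fY fX
           (beta_cond_indep nu e) phi,
         forall y a x, phi y a x = phi_cond_indep_beta e mu beta mu1 y a x &
         is_efficiency_bound P nu X A Y e fY fX
           (beta_cond_indep nu e) ('V_P[at_data X A Y phi])%E]).
Proof.
move=> beta mu0 mu1 mu01.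
have mu1_neq0 : mu1 != 0.
  exact/lt0r_neq0/(mu_const_true_gt0 consistency fY0_density fY1_density
    propensity regression AY_gt0 ignorability positivity).
split=> [monotone|independent] phi.
  have betaE : beta = 1 - mu0 / mu1.
    exact: (prob_necessary_causation_monotone consistency fY0_density fY1_density
      propensity regression AY_gt0 ignorability positivity monotone).
  have efficient : is_efficient_influence_function P nu X A Y e fY fX
      (beta_monotone nu e) phi.
    exact: (phi_monotone_efficient consistency fX_meas fX_ge0 fX_density fY_sum1
      fY0_density fY1_density propensity regression AY_gt0 ignorability positivity).
  split=> //; last by exists phi.
  have ratio : (1 - beta) / mu1 = mu0 / mu1 ^+ 2 by rewrite betaE; field.
  by move=> y a x; rewrite /phi_monotone_beta ratio.
have betaE : beta = 1 - mu01 / mu1.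
  exact: (prob_necessary_causation_cond_indep consistency fX_meas fX_ge0 fX_density
    fY_sum1 fY0_density fY1_density propensity regression AY_gt0 ignorability
    positivity independent).
have efficient : is_efficient_influence_function P nu X A Y e fY fX
    (beta_cond_indep nu e) phi.
  exact: (phi_cond_indep_efficient consistency fX_meas fX_ge0 fX_density fY_sum1
    fY0_density fY1_density propensity regression AY_gt0 ignorability positivity).
split=> //; last by exists phi.
have ratio : (1 - beta) / mu1 = mu01 / mu1 ^+ 2 by rewrite betaE; field.
by move=> y a x; rewrite /phi_cond_indep_beta ratio.
Qed.
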